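(* Let $k$ be a commutative field, let $p$ be a prime number different from the characteristic of $k$, and let $R$ be a ring whose cardinality is a power of $p$. If $F$ is a finitely generated object of $\mathcal{F}(R,k)$, then there exists a polynomial $P\in\mathbb{Q}[X]$ such that $\dim_k(F(R^n))=P(p^n)$ for all $n\in\mathbb{N}$.
   Context: $\mathcal{F}(R,k)$ is the category of all (not necessarily additive) functors from the category $\mathbf{P}(R)$ of finitely generated projective left $R$-modules to $k$-vector spaces. A functor is finitely generated iff it is a quotient of a finite direct sum of functors $k[\mathrm{Hom}_R(a_i,-)]$ with $a_i\in\mathbf{P}(R)$, where $k[E]$ is the $k$-vector space with basis the set $E$. *)

(* Defs.v *)
From HB Require Import structures.
From mathcomp Require Import all_boot all_order all_algebra.
From mathcomp Require Import finmap boolp.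
From mathcomp.multinomials Require Import monalg.

Set Implicit Arguments.
Unset Strict Implicit.
Unset Printing Implicit Defensive.

Import GRing.Theory.
Local Open Scope ring_scope.

Section FinitelyGeneratedProjective.
Variable R : pzRingType.
Implicit Types M N V : lmodType R.

Definition finitely_generated V : Prop :=
  exists n (g : 'I_n -> V), forall v, exists c : 'I_n -> R,
    v = \sum_i c i *: g i.

Definition projective V : Prop :=
  forall M N (q : {linear M -> N}) (f : {linear V -> N}),
    (forall y, exists x, q x = y) ->
    exists g : {linear V -> M}, q \o g =1 f.

(* The objects of P(R); morphisms a -> b are the elements of {linear a -> b}. *)
Record fgproj := Fgproj {
  fgproj_mod :> lmodType R;
  fgprojP : finitely_generated fgproj_mod /\ projective fgproj_mod }.

Lemma rV_fgproj n :
  finitely_generated 'rV[R]_n /\ projective 'rV[R]_n.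
Proof.
split.
  exists n, (fun i => delta_mx 0 i) => v.
  by exists (fun i => v 0 i); rewrite {1}(row_sum_delta v).
move=> M N q f q_surj.
have ex i : exists x, q x == f (delta_mx 0 i).
  by have [x qx] := q_surj (f (delta_mx 0 i)); exists x; apply/eqP.
pose g (v : 'rV[R]_n) := \sum_i v 0 i *: xchoose (ex i).
have g_lin : linear g.
  move=> a u v; rewrite /g scaler_sumr -big_split /=.
  by apply: eq_bigr => i _; rewrite !mxE scalerDl scalerA.
pose gM := GRing.isLinear.Build R _ _ _ g g_lin.
pose gL : {linear 'rV[R]_n -> M} := HB.pack g gM.
exists gL => v /=.
rewrite /g linear_sum [in RHS](row_sum_delta v) linear_sum.
by apply: eq_bigr => i _; rewrite !linearZ (eqP (xchooseP (ex i))).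
Qed.

(* The left R-module R^n, as an object of P(R). *)
Definition free_mod (n : nat) : fgproj := Fgproj (rV_fgproj n).

End FinitelyGeneratedProjective.

(* Functoriality of E |-> k[E]: the linear map sending the basis element      *)
(* << e >> to << h e >>.                                                      *)
Section MalgMap.
Variables (k : fieldType) (K L : choiceType) (h : K -> L).

Definition malg_map (x : {malg k[K]}) : {malg k[L]} :=
  \sum_(e <- msupp x) << x@_e *g h e >>.

Lemma malg_mapEw (d : {fset K}) x : (msupp x `<=` d)%fset ->
  malg_map x = \sum_(e <- d) << x@_e *g h e >>.
Proof.
move=> le; rewrite /malg_map (big_fset_incl _ le) //= => e _ /mcoeff_outdom ->.
by rewrite raddf0.
Qed.

Lemma malg_map_linear : linear malg_map.
Proof.
move=> a x y; pose d := (msupp x `|` msupp y `|` msupp (a *: x + y))%fset.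
rewrite (@malg_mapEw d); last by rewrite /d fsubsetUr.
rewrite (@malg_mapEw d x); last by rewrite /d -fsetUA fsubsetUl.
rewrite (@malg_mapEw d y); last by rewrite /d fsetUAC fsubsetUr.
rewrite scaler_sumr -big_split /=; apply: eq_bigr => e _.
rewrite mcoeffD mcoeffZ raddfD /=; congr (_ + _).
by apply/malgP => l; rewrite mcoeffZ !mcoeffU mulrnAr.
Qed.

HB.instance Definition _ :=
  GRing.isLinear.Build k {malg k[K]} {malg k[L]} _ malg_map malg_map_linear.

Lemma malg_mapU c e : malg_map << c *g e >> = << c *g h e >>.
Proof. by rewrite (malg_mapEw msuppU_le) big_seq_fset1 mcoeffUU. Qed.

Lemma malg_linear_ext (V : lmodType k) (f g : {linear {malg k[K]} -> V}) :
  (forall e, f << e >> = g << e >>) -> f =1 g.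
Proof.
move=> fg x; rewrite (monalgE x) !linear_sum; apply: eq_bigr => e _.
suff -> : << x@_e *g e >> = x@_e *: << 1 *g e >> :> {malg k[K]}.
  by rewrite !linearZ fg.
by apply/malgP => l; rewrite mcoeffZ !mcoeffU mulrnAr mulr1.
Qed.

End MalgMap.

Lemma malg_map_id (k : fieldType) (K : choiceType) (h : K -> K) :
  h =1 id -> @malg_map k K K h =1 id.
Proof.
move=> hE; apply: (malg_linear_ext (f := malg_map h) (g := idfun)) => e /=.
by rewrite malg_mapU hE.
Qed.

Lemma malg_map_comp (k : fieldType) (K L M : choiceType)
    (h : K -> L) (g : L -> M) (gh : K -> M) : gh =1 g \o h ->
  @malg_map k K M gh =1 malg_map g \o malg_map h.
Proof.
move=> ghE; apply: (malg_linear_ext (f := malg_map gh)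
                      (g := malg_map g \o malg_map h)) => e /=.
by rewrite !malg_mapU ghE.
Qed.

Lemma linear_eqfun (R : pzRingType) (U V : lmodType R)
  (f g : {linear U -> V}) : f =1 g -> f = g.
Proof.
case: f g => [f cf] [g cg] /= /funext fg; case: _ / fg cg => cg.
congr GRing.Linear.Pack.
case: cf cg => [[pf] [sf]] [[pg] [sg]].
by rewrite (Prop_irrelevance pf pg) (Prop_irrelevance sf sg).
Qed.

Section FunctorCategory.
Variables (R : pzRingType) (k : fieldType).

(* The objects of F(R, k); fmap is not assumed to be additive. *)
Record functor := Functor {
  fobj :> fgproj R -> lmodType k;
  fmap : forall a b : fgproj R, {linear a -> b} -> {linear fobj a -> fobj b};
  fmap_id : forall a : fgproj R, fmap (idfun : {linear a -> a}) =1 idfun;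
  fmap_comp : forall (a b c : fgproj R)
    (f : {linear a -> b}) (g : {linear b -> c}),
    fmap (g \o f : {linear a -> c}) =1 fmap g \o fmap f }.

Record nat_trans (F G : functor) := NatTrans {
  ntapp :> forall a : fgproj R, {linear F a -> G a};
  nt_natural : forall (a b : fgproj R) (f : {linear a -> b}),
    ntapp b \o fmap F f =1 fmap G f \o ntapp a }.

(* The functor k[Hom_R(a, -)]; {classic _} makes Hom_R(a, b) a choiceType,    *)
(* as the library's free modules require.                                     *)
Section Representable.
Variable a : fgproj R.

Definition hom (b : fgproj R) := {classic {linear a -> b}}.

Definition hom_post (b c : fgproj R) (g : {linear b -> c}) (h : hom b) : hom c :=
  (g \o (h : {linear a -> b}) : {linear a -> c}).

Definition rep_obj (b : fgproj R) : lmodType k := {malg k[hom b]}.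

Definition rep_map (b c : fgproj R) (g : {linear b -> c}) :
  {linear rep_obj b -> rep_obj c} := malg_map (hom_post g).

Lemma rep_map_id (b : fgproj R) : rep_map (idfun : {linear b -> b}) =1 idfun.
Proof. by apply: malg_map_id => h; apply: linear_eqfun. Qed.

Lemma rep_map_comp (b c d : fgproj R)
    (f : {linear b -> c}) (g : {linear c -> d}) :
  rep_map (g \o f : {linear b -> d}) =1 rep_map g \o rep_map f.
Proof. by apply: malg_map_comp => h; apply: linear_eqfun. Qed.

Definition rep : functor := Functor rep_map_id rep_map_comp.

End Representable.

Definition zero_functor : functor :=
  @Functor (fun=> 'rV[k]_0) (fun _ _ _ => idfun)
    (fun _ _ => erefl) (fun _ _ _ _ _ _ => erefl).

Section DirectSum.
Variables F G : functor.

Definition dsum_obj (b : fgproj R) : lmodType k := (F b * G b)%type.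

Definition dsum_fun (b c : fgproj R) (g : {linear b -> c}) (x : dsum_obj b) : dsum_obj c :=
  (fmap F g x.1, fmap G g x.2).

Lemma dsum_fun_linear (b c : fgproj R) (g : {linear b -> c}) : linear (dsum_fun g).
Proof. by move=> t x y; rewrite /dsum_fun /= !linearP. Qed.

HB.instance Definition _ (b c : fgproj R) (g : {linear b -> c}) :=
  GRing.isLinear.Build k (dsum_obj b) (dsum_obj c) _ (dsum_fun g)
    (dsum_fun_linear g).

Definition dsum_map (b c : fgproj R) (g : {linear b -> c}) :
  {linear dsum_obj b -> dsum_obj c} := dsum_fun g.

Lemma dsum_map_id (b : fgproj R) : dsum_map (idfun : {linear b -> b}) =1 idfun.
Proof. by case=> x y; rewrite /= /dsum_fun !fmap_id. Qed.

Lemma dsum_map_comp (b c d : fgproj R)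
    (f : {linear b -> c}) (g : {linear c -> d}) :
  dsum_map (g \o f : {linear b -> d}) =1 dsum_map g \o dsum_map f.
Proof. by case=> x y; rewrite /= /dsum_fun !fmap_comp. Qed.

Definition dsum : functor := Functor dsum_map_id dsum_map_comp.

End DirectSum.

(* F is a quotient of a finite direct sum of functors k[Hom_R(a_i, -)];       *)
(* quotients in a functor category are computed objectwise.                   *)
Definition finitely_generated_functor (F : functor) : Prop :=
  exists (a : seq (fgproj R))
         (phi : nat_trans (foldr dsum zero_functor (map rep a)) F),
    forall (b : fgproj R) (y : F b), exists x, phi b x = y.

End FunctorCategory.

Definition has_dim (k : fieldType) (V : lmodType k) (d : nat) : Prop :=
  inhabited (Vector.axiom d V).

(* Main.v *)
(* A finitely generated functor restricted to the modules R^n is a quotient   *)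
(* of a finite sum of functors P_T : n |-> k[T^n], T a finite right R-module   *)
(* on whose tuples matrices act, so it suffices that every subfunctor K of P_T *)
(* has dimension polynomial in p^n.  This goes by induction on |T|.  Let J be  *)
(* spanned by the non-generating tuples (the sum of the images of the P_T',    *)
(* T' < T) and I be the intersection of the kernels of P_T -> P_(T/B), B != 0; *)
(* subfunctors of J and quotients of P_T by subfunctors containing I are       *)
(* covered by the induction hypothesis.  For x a generating n-tuple, w in I    *)
(* and u in P_T(n),                                                            *)
(*    \sum_A w(xA) [A] u = c \sum_(g in Aut T) u(gx) (g w),                    *)
(* where c is a power of p, hence invertible in k.  So if M is the space of    *)
(* functions m on Aut T such that \sum_g m(g) g maps I into K (as do all       *)
(* translates of m), then M contains every g |-> u(gx) with u in K.  Put       *)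
(* L := K + J + \sum_(m in M) m P_T.  Then L / (K + J) is a sum of quotients   *)
(* of P_T / I, and dim (L / J) is dim M times the number of orbits of          *)
(* generating tuples, on which Aut T acts freely.                              *)
From HB Require Import structures.
From mathcomp Require Import all_boot all_order all_algebra all_fingroup.
From mathcomp Require Import finmap boolp.
From mathcomp.multinomials Require Import monalg.
From mathcomp Require Import ring lra.
Require Import Defs.
Set Implicit Arguments.
Unset Strict Implicit.
Unset Printing Implicit Defensive.
Import GRing.Theory Num.Theory.
Local Open Scope ring_scope.

(** * Families of vector spaces with operators *)

(** A family with operators is [good] when all its stable subfamilies have dimension polynomial in
    p^n. The heart is [good_tuprep]: k[T^n] is good for every finite right module T, by strong
    induction on |T| with [polydim_step] as induction step. The proper submodules and proper
    quotients of T, good by induction, control the two ends of a subfunctor K: [polydim_sub_sum]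
    handles what lies inside J, and [polydim_sup_cap] what contains I.

    Between these ends, K is governed by one subspace M of k[Aut T], the same for all n. This comes
    from [conv_key]. Weighting the matrices A by w(xA), with w in I, cancels the contribution of
    every tuple outside the orbit of x, so the coefficients of u in K along that orbit multiply I
    into K, up to the number of A with xA = 0. That number is a power of p, and this is where the
    characteristic of k matters. Enlarging K + J to L by the spaces m P_T makes L/J known exactly:
    one copy of M for each orbit of generating tuples. The orbits are counted by [polyfun_card_gen]
    and the freeness of the action.

    Finally F(R^n) is the quotient of a good family by a stable kernel ([covered_foldr],
    [covered_quotient]), so its dimension is a difference of two polynomial functions. *)

Section PolynomialFunctions.
Variable p : nat.

Definition polyfun (f : nat -> rat) : Prop :=
  exists P : {poly rat}, forall n, f n = P.[(p ^ n)%:R].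

Lemma eq_polyfun f g : f =1 g -> polyfun f -> polyfun g.
Proof. by move=> fg [P fP]; exists P => n; rewrite -fg. Qed.

Lemma polyfun_const c : polyfun (fun=> c).
Proof. by exists c%:P => n; rewrite hornerC. Qed.

Lemma polyfunD f g :
  polyfun f -> polyfun g -> polyfun (fun n => f n + g n).
Proof. by move=> [P fP] [Q gQ]; exists (P + Q) => n; rewrite hornerD fP gQ. Qed.

Lemma polyfunM f g :
  polyfun f -> polyfun g -> polyfun (fun n => f n * g n).
Proof. by move=> [P fP] [Q gQ]; exists (P * Q) => n; rewrite hornerM fP gQ. Qed.

Lemma polyfunB f g :
  polyfun f -> polyfun g -> polyfun (fun n => f n - g n).
Proof. by move=> [P fP] [Q gQ]; exists (P - Q) => n; rewrite hornerD hornerN fP gQ. Qed.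

Lemma polyfun_sum (I : Type) (s : seq I) (Q : pred I) (f : I -> nat -> rat) :
  (forall i, Q i -> polyfun (f i)) -> polyfun (fun n => \sum_(i <- s | Q i) f i n).
Proof.
move=> fP; elim: s => [|i s IH].
  by apply: eq_polyfun (polyfun_const 0) => n; rewrite big_nil.
case Qi: (Q i).
  apply: eq_polyfun (polyfunD (fP i Qi) IH) => n.
  by rewrite big_cons Qi.
by apply: eq_polyfun IH => n; rewrite big_cons Qi.
Qed.

Lemma polyfun_exp c j : c = (p ^ j)%N -> polyfun (fun n => (c ^ n)%:R).
Proof.
by move=> ->; exists 'X^j => n; rewrite hornerXn -natrX -!expnM mulnC.
Qed.

End PolynomialFunctions.

(** * Good families and their closure properties *)

Section Representations.
Variables (k : fieldType) (p : nat) (Ar : nat -> nat -> Type).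

(* Neither identities nor composites are required to be respected. *)
Record vrep := VRep {
  sp :> nat -> vectType k;
  op : forall n m, Ar n m -> 'Hom(sp n, sp m) }.

Definition stable (X : vrep) (U : forall n, {vspace X n}) : Prop :=
  forall n m (A : Ar n m) u, u \in U n -> op X A u \in U m.

Definition natural (X Y : vrep) (phi : forall n, 'Hom(X n, Y n)) : Prop :=
  forall n m (A : Ar n m) u, phi m (op X A u) = op Y A (phi n u).

Definition polydim (X : vrep) (U : forall n, {vspace X n}) : Prop :=
  polyfun p (fun n => (\dim (U n))%:R).

Definition good (X : vrep) : Prop := forall U, @stable X U -> polydim U.

Section Stable.
Variables X Y : vrep.

Lemma stable_full : @stable X (fun n => fullv).
Proof. by move=> n m A u _; apply: memvf. Qed.

Lemma stable_cap U V :
  @stable X U -> @stable X V -> stable (fun n => U n :&: V n)%VS.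
Proof.
by move=> sU sV n m A u; rewrite !memv_cap => /andP[/sU -> /sV ->].
Qed.

Lemma stable_add U V :
  @stable X U -> @stable X V -> stable (fun n => U n + V n)%VS.
Proof.
move=> sU sV n m A u /memv_addP[v vU [w wV ->]].
by rewrite linearD memv_add ?sU ?sV.
Qed.

Variable phi : forall n, 'Hom(X n, Y n).
Hypothesis nphi : natural phi.

Lemma stable_ker : stable (fun n => lker (phi n)).
Proof. by move=> n m A u; rewrite !memv_ker nphi => /eqP->; rewrite linear0. Qed.

Lemma stable_img U : stable U -> stable (fun n => phi n @: U n)%VS.
Proof.
move=> sU n m A u /memv_imgP[v vU ->].
by rewrite -nphi memv_img ?sU.
Qed.

Lemma stable_preim U : stable U -> stable (fun n => phi n @^-1: U n)%VS.
Proof. by move=> sU n m A u; rewrite -!memv_preim nphi => /sU. Qed.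

End Stable.

Lemma dim_preim (V W : vectType k) (f : 'Hom(V, W)) (U : {vspace W}) :
  (\dim (f @^-1: U) = \dim (lker f) + \dim (U :&: limg f))%N.
Proof.
rewrite -(limg_ker_dim f (f @^-1: U)%VS); congr (_ + _)%N; congr (\dim _).
  apply/capv_idPr; apply/subvP => u; rewrite memv_ker => /eqP fu.
  by rewrite -memv_preim fu mem0v.
apply/eqP; rewrite eqEsubv; apply/andP; split; apply/subvP => w.
  case/memv_imgP=> v; rewrite -memv_preim => fv ->.
  by rewrite memv_cap fv memv_img ?memvf.
rewrite memv_cap => /andP[wU /memv_imgP[v _ wE]].
by rewrite wE memv_img // -memv_preim -wE.
Qed.

Lemma dim_sum_cap_rat (V : vectType k) (U W : {vspace V}) :
  (\dim (U + W))%:R + (\dim (U :&: W))%:R = (\dim U)%:R + (\dim W)%:R :> rat.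
Proof. by rewrite -!natrD dimv_sum_cap. Qed.

Section Closure.
Variables (X Y : vrep) (phi : forall n, 'Hom(X n, Y n)).
Hypothesis nphi : natural phi.

(** By rank-nullity this dimension is that of the preimage of U minus that of the kernel, and both
    of these are stable in X. *)
Lemma polydim_limg : good X -> forall U, stable U ->
  polydim (fun n => U n :&: limg (phi n))%VS.
Proof.
move=> gX U sU.
have h1 := gX _ (stable_preim nphi sU).
have h2 := gX _ (stable_ker nphi).
apply: eq_polyfun (polyfunB h1 h2) => n.
by rewrite dim_preim natrD addrAC subrr add0r.
Qed.

Lemma polydim_limg_sub : good X -> forall U, stable U ->
  (forall n, (U n <= limg (phi n))%VS) -> polydim U.
Proof.
move=> gX U sU le; apply: eq_polyfun (polydim_limg gX sU) => n.
by congr (\dim _)%:R; apply/capv_idPl.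
Qed.

(** U and W meet the kernel in the same subspace, so W/U is isomorphic to phi(W)/phi(U), a quotient
    of stable families of Y. *)
Lemma polydim_quot : good Y -> forall U W, stable U -> stable W ->
  (forall n, (U n <= W n)%VS) ->
  (forall n, (W n :&: lker (phi n) <= U n)%VS) ->
  polyfun p (fun n => (\dim (W n))%:R - (\dim (U n))%:R).
Proof.
move=> gY U W sU sW UW kU.
have h1 := gY _ (stable_img nphi sW).
have h2 := gY _ (stable_img nphi sU).
apply: eq_polyfun (polyfunB h1 h2) => n.
have e1 := limg_ker_dim (phi n) (W n).
have e2 := limg_ker_dim (phi n) (U n).
have e3 : (W n :&: lker (phi n) = U n :&: lker (phi n))%VS.
  by apply/eqP; rewrite eqEsubv subv_cap kU capvSr capvS.
by rewrite -e1 -e2 e3 !natrD; ring.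
Qed.

Lemma good_ext : good Y ->
  (forall U, stable U -> (forall n, (U n <= lker (phi n))%VS) -> polydim U) ->
  good X.
Proof.
move=> gY gK U sU.
have h1 := gK _ (stable_cap sU (stable_ker nphi)) (fun n => capvSr _ _).
have h2 := gY _ (stable_img nphi sU).
by apply: eq_polyfun (polyfunD h1 h2) => n; rewrite -natrD limg_ker_dim.
Qed.

End Closure.

Definition good_image (Y : vrep) (J : forall n, {vspace Y n}) : Prop :=
  exists (X : vrep) (phi : forall n, 'Hom(X n, Y n)),
    [/\ good X, natural phi & forall n, J n = limg (phi n)].

(** Induction on the list: with J' the sum of the remaining terms, U is an extension of (U + J')/J'
    by U ∩ J'. *)
Lemma polydim_sub_sum (Y : vrep) (I : Type) (Q : pred I)
    (J : I -> forall n, {vspace Y n}) s :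
  (forall i, Q i -> good_image (J i)) ->
  forall U, stable U -> (forall n, (U n <= \sum_(i <- s | Q i) J i n)%VS) ->
  polydim U.
Proof.
move=> gJ; elim: s => [|i s IH] U sU le.
  apply: eq_polyfun (polyfun_const p 0) => n.
  by have := le n; rewrite big_nil subv0 => /eqP->; rewrite dimv0.
case Qi: (Q i); last first.
  by apply: IH => // n; have := le n; rewrite big_cons Qi.
have [X [phi [gX nphi JE]]] := gJ i Qi.
pose J' n := (\sum_(i <- s | Q i) J i n)%VS.
have sJ : forall i, Q i -> stable (J i).
  move=> j Qj; have [Z [psi [_ npsi JE']]] := gJ j Qj.
  move=> n m A u; rewrite !JE'.
  exact: (stable_img npsi (@stable_full Z)).
have sJ' : stable J'.
  rewrite /J'; elim: (s) => [|j t IHt] n m A u.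
    by rewrite !big_nil !memv0 => /eqP->; rewrite linear0.
  rewrite !big_cons; case: ifP => Qj; last exact: IHt.
  exact: (stable_add (sJ j Qj) IHt).
have h1 := IH _ (stable_cap sU sJ') (fun n => capvSr _ _).
have sUJ := stable_add sU sJ'.
have h2 := polydim_limg nphi gX sUJ.
have h3 := polydim_limg nphi gX sJ'.
(* modular law: (U + J') / J' is a quotient of (U + J') :&: J i *)
apply: eq_polyfun (polyfunD h1 (polyfunB h2 h3)) => n.
rewrite -!JE.
have e1 := dim_sum_cap_rat (U n) (J' n).
have e2 := dim_sum_cap_rat (J' n) ((U n + J' n) :&: J i n).
have e3 : (J' n + (U n + J' n) :&: J i n = U n + J' n)%VS.
  rewrite [((U n + _) :&: _)%VS]capvC vspace_modl ?addvSr //.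
  apply/capv_idPr; rewrite subv_add addvSl andbT [(J' n + _)%VS]addvC.
  by have := le n; rewrite big_cons Qi.
have e4 : (J' n :&: ((U n + J' n) :&: J i n) = J' n :&: J i n)%VS.
  by rewrite capvA; congr (_ :&: _)%VS; apply/capv_idPl; apply: addvSr.
by rewrite e3 e4 in e2; lra.
Qed.

Definition good_kernel (Y : vrep) (I : forall n, {vspace Y n}) : Prop :=
  exists (X : vrep) (phi : forall n, 'Hom(Y n, X n)),
    [/\ good X, natural phi & forall n, I n = lker (phi n)].

(** Dual to [polydim_sub_sum]. With I' the intersection of the remaining terms, Y/U is built from
    Y/(U + I') and (U + I')/U = I'/(U ∩ I'). The map phi sees the latter faithfully because I' ∩ ker
    phi lies in U. *)
Lemma polydim_sup_cap (Y : vrep) (Idx : Type) (Q : pred Idx)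
    (I : Idx -> forall n, {vspace Y n}) s :
  (forall i, Q i -> good_kernel (I i)) ->
  forall U, stable U -> (forall n, (\bigcap_(i <- s | Q i) I i n <= U n)%VS) ->
  polyfun p (fun n => (\dim {:Y n})%:R - (\dim (U n))%:R).
Proof.
move=> gI; elim: s => [|i s IH] U sU le.
  apply: eq_polyfun (polyfun_const p 0) => n.
  have := le n; rewrite big_nil => leU.
  suff -> : U n = fullv by rewrite subrr.
  by apply/eqP; rewrite eqEsubv subvf.
case Qi: (Q i); last first.
  by apply: IH => // n; have := le n; rewrite big_cons Qi.
have [X [phi [gX nphi IE]]] := gI i Qi.
pose I' n := (\bigcap_(i <- s | Q i) I i n)%VS.
have sI : forall i, Q i -> stable (I i).
  move=> j Qj; have [Z [psi [_ npsi IE']]] := gI j Qj.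
  by move=> n m A u; rewrite !IE'; apply: (stable_ker npsi).
have sI' : stable I'.
  rewrite /I'; elim: (s) => [|j t IHt] n m A u.
    by rewrite !big_nil !memvf.
  rewrite !big_cons; case: ifP => Qj; last exact: IHt.
  exact: (stable_cap (sI j Qj) IHt).
have sUI := stable_add sU sI'.
have h1 := IH _ sUI (fun n => addvSr _ _).
have sUcI := stable_cap sU sI'.
have h2 : polyfun p (fun n => (\dim (I' n))%:R - (\dim (U n :&: I' n))%:R).
  apply: (polydim_quot nphi gX sUcI sI') => n; first exact: capvSr.
  rewrite -IE subv_cap capvSl andbT.
  by have := le n; rewrite big_cons Qi capvC.
apply: eq_polyfun (polyfunD h1 h2) => n.
have e1 := dim_sum_cap_rat (U n) (I' n).
by lra.
Qed.

(** The images are added one at a time: if L is the sum so far, (L + im phi_i)/L is Y modulo the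
    preimage of L, and that preimage contains I. *)
Lemma polydim_add_limg (Y : vrep) (I W : forall n, {vspace Y n}) (Idx : eqType)
    (phi : Idx -> forall n, 'End(Y n)) (s : seq Idx) :
  (forall U, stable U -> (forall n, (I n <= U n)%VS) ->
     polyfun p (fun n => (\dim {:Y n})%:R - (\dim (U n))%:R)) ->
  stable W ->
  (forall i, i \in s -> natural (phi i)) ->
  (forall i n, i \in s -> (I n <= phi i n @^-1: W n)%VS) ->
  polyfun p (fun n => (\dim (W n + \sum_(i <- s) limg (phi i n)))%:R - (\dim (W n))%:R).
Proof.
move=> hI sW; elim: s => [|i s IH] nphi Iphi.
  apply: eq_polyfun (polyfun_const p 0) => n.
  by rewrite big_nil addv0 subrr.
have nphi' j : j \in s -> natural (phi j).
  by move=> js; apply: nphi; rewrite inE js orbT.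
have ii : i \in i :: s by rewrite inE eqxx.
pose L n := (W n + \sum_(j <- s) limg (phi j n))%VS.
have sL : stable L.
  apply: stable_add => //.
  have slimg j : j \in s -> stable (fun n => limg (phi j n)).
    by move=> js; apply: (stable_img (nphi' j js) (@stable_full Y)).
  move: slimg; elim: (s) => [|j t IHt] st n m A u.
    by rewrite !big_nil !memv0 => /eqP->; rewrite linear0.
  rewrite !big_cons; move: n m A u; apply: (stable_add (st j (mem_head j t))).
  by apply: IHt => l lt; apply: st; rewrite inE lt orbT.
have h1 := IH nphi' (fun j n js => Iphi j n (mem_behead (s := i :: s) js)).
have h2 : polyfun p (fun n => (\dim {:Y n})%:R - (\dim (phi i n @^-1: L n))%:R).
  apply: hI => [|n]; first exact: (stable_preim (nphi i ii) sL).
  by apply: subv_trans (Iphi i n ii) _; apply: lpreimS; apply: addvSl.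
apply: eq_polyfun (polyfunD h1 h2) => n.
rewrite big_cons [(limg _ + _)%VS]addvC addvA -/(L n) dim_preim -(limg_ker_dim (phi i n) fullv).
rewrite (capv_idPr (subvf (lker _))) !natrD.
have e := dim_sum_cap_rat (L n) (limg (phi i n)).
by lra.
Qed.

Section Product.
Variables X Y : vrep.

Definition prod_op_fun n m (A : Ar n m) (u : X n * Y n) : X m * Y m :=
  (op X A u.1, op Y A u.2).

Lemma prod_op_linear n m (A : Ar n m) : linear (prod_op_fun A).
Proof. by move=> a u v; rewrite /prod_op_fun /= !linearP. Qed.

HB.instance Definition _ n m (A : Ar n m) :=
  GRing.isLinear.Build k (X n * Y n)%type (X m * Y m)%type _ (prod_op_fun A)
    (prod_op_linear A).

Definition prod_rep : vrep :=
  @VRep (fun n => (X n * Y n)%type) (fun n m A => linfun (prod_op_fun A)).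

Definition inl_fun n (u : X n) : (X n * Y n)%type := (u, 0).

Lemma inl_linear n : linear (@inl_fun n).
Proof. by move=> a u v; congr (_, _); rewrite /= scaler0 addr0. Qed.

HB.instance Definition _ n :=
  GRing.isLinear.Build k (X n) (X n * Y n)%type _ (@inl_fun n) (@inl_linear n).

Definition prod_snd n (u : (X n * Y n)%type) : Y n := u.2.

Lemma prod_snd_linear n : linear (@prod_snd n).
Proof. by []. Qed.

HB.instance Definition _ n :=
  GRing.isLinear.Build k (X n * Y n)%type (Y n) _ (@prod_snd n) (@prod_snd_linear n).

Lemma good_prod : good X -> good Y -> good prod_rep.
Proof.
move=> gX gY.
have nS : @natural prod_rep Y (fun n => linfun (@prod_snd n)).
  by move=> n m A u; rewrite !lfunE /= ?lfunE.
have nI : @natural X prod_rep (fun n => linfun (@inl_fun n)).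
  by move=> n m A u; rewrite !lfunE /= ?lfunE /= /prod_op_fun /= linear0.
apply: (good_ext nS gY) => U sU le.
apply: (polydim_limg_sub nI gX sU) => n; apply/subvP => -[u v] uvU.
have /subvP/(_ _ uvU) := le n; rewrite memv_ker lfunE /= => /eqP v0.
apply/memv_imgP; exists u; rewrite ?memvf // lfunE /= /inl_fun.
by move: v0; rewrite /prod_snd /= => ->.
Qed.

End Product.

End Representations.

(** * Finite right modules *)

HB.mixin Record isRightModule (R : pzRingType) T of FinRing.Zmodule T := {
  racts : T -> R -> T;
  ractsA : forall x a b, racts x (a * b) = racts (racts x a) b;
  racts1 : forall x, racts x 1 = x;
  ractsDl : forall x y a, racts (x + y) a = racts x a + racts y a;
  ractsDr : forall x a b, racts x (a + b) = racts x a + racts x b }.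

#[short(type="finRmod")]
HB.structure Definition FinRmod (R : pzRingType) :=
  {T of FinRing.Zmodule T & isRightModule R T}.

Local Notation "x ** a" := (racts x a) (at level 40, left associativity).

Section RightModules.
Variables (R : pzRingType) (T : finRmod R).

Lemma racts0l a : 0 ** a = 0 :> T.
Proof. by apply: (addrI (0 ** a)); rewrite -ractsDl !addr0. Qed.

Lemma racts0r (x : T) : x ** (0 : R) = 0.
Proof. by apply: (addrI (x ** 0)); rewrite -ractsDr !addr0. Qed.

Lemma ractsNl (x : T) (a : R) : - x ** a = - (x ** a).
Proof. by apply: (addrI (x ** a)); rewrite -ractsDl !subrr racts0l. Qed.

Lemma ractsN1 (x : T) : x ** (- 1 : R) = - x.
Proof.
by apply: (addrI x); rewrite -{1}(racts1 (R := R) x) -ractsDr !subrr racts0r.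
Qed.

Lemma racts_suml (I : Type) (s : seq I) (P : pred I) (F : I -> T) (a : R) :
  (\sum_(i <- s | P i) F i) ** a = \sum_(i <- s | P i) F i ** a.
Proof.
by apply: (big_morph (fun x => x ** a)); [move=> x y; apply: ractsDl | apply: racts0l].
Qed.

Lemma racts_sumr (I : Type) (s : seq I) (P : pred I) (F : I -> R) (x : T) :
  x ** (\sum_(i <- s | P i) F i) = \sum_(i <- s | P i) x ** F i.
Proof.
by apply: (big_morph (racts x)); [apply: ractsDr | apply: racts0r].
Qed.

End RightModules.

Definition rlinear (R : pzRingType) (T U : finRmod R) (h : T -> U) : Prop :=
  forall (a : R) x y, h (x ** a + y) = h x ** a + h y.

Section RLinear.
Variables (R : pzRingType) (T U : finRmod R) (h : T -> U).
Hypothesis hlin : rlinear h.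

Lemma rlinearD x y : h (x + y) = h x + h y.
Proof. by have := hlin 1 x y; rewrite !racts1. Qed.

Lemma rlinear0 : h 0 = 0.
Proof. by apply: (addrI (h 0)); rewrite -rlinearD !addr0. Qed.

Lemma rlinearZ x (a : R) : h (x ** a) = h x ** a.
Proof. by have := hlin a x 0; rewrite rlinear0 !addr0. Qed.

Lemma rlinear_sum (I : Type) (s : seq I) (P : pred I) (F : I -> T) :
  h (\sum_(i <- s | P i) F i) = \sum_(i <- s | P i) h (F i).
Proof. by apply: (big_morph h); [apply: rlinearD | apply: rlinear0]. Qed.

End RLinear.

Section Submodules.
Variables (R : finPzRingType) (T : finRmod R).
Implicit Types A B : {set T}.

Definition submod A : bool :=
  (0 \in A) &&
  [forall a : R, forall x, forall y, (x \in A) ==> (y \in A) ==> (x ** a + y \in A)].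

Lemma submodP A :
  reflect (0 \in A /\ forall (a : R) x y, x \in A -> y \in A -> x ** a + y \in A)
    (submod A).
Proof.
apply: (iffP andP) => -[A0 AP]; split=> //.
  move=> a x y xA yA; move/forallP/(_ a)/forallP/(_ x)/forallP/(_ y): AP.
  by rewrite xA yA.
apply/forallP=> a; apply/forallP=> x; apply/forallP=> y.
by apply/implyP=> xA; apply/implyP=> yA; apply: AP.
Qed.

Section Closed.
Variable A : {set T}.
Hypothesis HA : submod A.

Lemma submod0 : 0 \in A. Proof. by case/submodP: HA. Qed.

Lemma submodZD (a : R) x y : x \in A -> y \in A -> x ** a + y \in A.
Proof. by case/submodP: HA => _; apply. Qed.

Lemma submodD x y : x \in A -> y \in A -> x + y \in A.
Proof. by rewrite -{2}(racts1 (R := R) x); apply: submodZD. Qed.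

Lemma submodZ (a : R) x : x \in A -> x ** a \in A.
Proof. by move=> xA; rewrite -[_ ** _]addr0 submodZD ?submod0. Qed.

Lemma submodN x : x \in A -> - x \in A.
Proof. by rewrite -(ractsN1 (R := R)); apply: submodZ. Qed.

Lemma submodB x y : x \in A -> y \in A -> x - y \in A.
Proof. by move=> xA yA; rewrite submodD ?submodN. Qed.

Lemma submod_sum (I : Type) (s : seq I) (F : I -> T) :
  (forall i, F i \in A) -> \sum_(i <- s) F i \in A.
Proof.
move=> FA; elim: s => [|i s IH]; first by rewrite big_nil submod0.
by rewrite big_cons submodD.
Qed.

End Closed.

Definition subm A & submod A := {x : T | x \in A}.

Section SubModule.
Variables (A : {set T}) (HA : submod A).
Local Notation Y := (subm HA).

HB.instance Definition _ := Finite.on Y.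

Definition subm0 : Y := Sub 0 (submod0 HA).
Definition submA (x y : Y) : Y := Sub (val x + val y) (submodD HA (valP x) (valP y)).
Definition submO (x : Y) : Y := Sub (- val x) (submodN HA (valP x)).
Definition submS (x : Y) (a : R) : Y := Sub (val x ** a) (submodZ HA a (valP x)).

Fact submA_assoc : associative submA.
Proof. by move=> x y z; apply: val_inj; rewrite /= addrA. Qed.
Fact submA_comm : commutative submA.
Proof. by move=> x y; apply: val_inj; rewrite /= addrC. Qed.
Fact subm_add0 : left_id subm0 submA.
Proof. by move=> x; apply: val_inj; rewrite /= add0r. Qed.
Fact subm_addN : left_inverse subm0 submO submA.
Proof. by move=> x; apply: val_inj; rewrite /= addNr. Qed.
HB.instance Definition _ :=
  GRing.isZmodule.Build Y submA_assoc submA_comm subm_add0 subm_addN.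

Fact subm_ractsA x a b : submS x (a * b) = submS (submS x a) b.
Proof. by apply: val_inj; rewrite /= ractsA. Qed.
Fact subm_racts1 x : submS x 1 = x.
Proof. by apply: val_inj; rewrite /= racts1. Qed.
Fact subm_ractsDl x y a : submS (x + y) a = submS x a + submS y a.
Proof. by apply: val_inj; rewrite /= ractsDl. Qed.
Fact subm_ractsDr x a b : submS x (a + b) = submS x a + submS x b.
Proof. by apply: val_inj; rewrite /= ractsDr. Qed.
HB.instance Definition _ :=
  isRightModule.Build R Y subm_ractsA subm_racts1 subm_ractsDl subm_ractsDr.

Definition subm_val (x : Y) : T := val x.
Fact subm_val_linear : rlinear subm_val. Proof. by []. Qed.

Lemma subm_card : #|{: Y}| = #|A|.
Proof. by rewrite card_sig. Qed.

End SubModule.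

Lemma submodule_exists A : submod A ->
  exists (Y : finRmod R) (j : Y -> T),
    [/\ rlinear j, injective j, forall t, t \in A <-> exists y, j y = t & #|Y| = #|A|].
Proof.
move=> HA; exists (subm HA), (@subm_val A HA); split; first exact: subm_val_linear.
- exact: val_inj.
- move=> t; split=> [tA|[y <-]]; last exact: (valP y).
  by exists (Sub t tA).
- exact: subm_card.
Qed.

(** For a submodule A the picked element depends only on the coset of x. The quotient can thus live
    on a subset of T, and T -> T/A be replaced by a map T -> T with the same fibres. *)
Definition coset_repr A (x : T) : T := odflt x [pick y | y - x \in A].

Definition quom A & submod A := {x : T | coset_repr A x == x}.

Section QuotientModule.
Variables (A : {set T}) (HA : submod A).
Local Notation Y := (quom HA).
Local Notation repr := (coset_repr A).

Lemma coset_reprP x : repr x - x \in A.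
Proof.
rewrite /coset_repr; case: pickP => [//|/(_ x)/=].
by rewrite subrr submod0.
Qed.

Lemma coset_repr_eq x y : (repr x == repr y) = (x - y \in A).
Proof.
apply/eqP/idP=> [e|xyA].
  have -> : x - y = (repr y - y) - (repr x - x).
    by rewrite e opprB [RHS]addrC addrA subrK.
  by rewrite submodB ?coset_reprP.
rewrite /coset_repr (eq_pick (Q := fun z => z - y \in A)).
  by case: pickP => //= /(_ y); rewrite subrr submod0.
move=> z /=; apply/idP/idP=> zA.
  by rewrite -(subrK x z) -addrA submodD.
by rewrite -(subrK y z) -addrA submodD // -opprB submodN.
Qed.

Lemma coset_repr_id x : repr (repr x) == repr x.
Proof. by rewrite coset_repr_eq coset_reprP. Qed.

HB.instance Definition _ := Finite.on Y.

Definition quo (x : T) : Y := exist _ (repr x) (coset_repr_id x).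

Lemma quo_eq x y : (quo x == quo y) = (x - y \in A).
Proof. by rewrite -coset_repr_eq -val_eqE. Qed.

Lemma val_quo x : quo (val x) = x.
Proof. by apply: val_inj; rewrite /=; apply/eqP; apply: (valP x). Qed.

Lemma quo_ind (P : Y -> Prop) : (forall x, P (quo x)) -> forall x, P x.
Proof. by move=> PQ x; rewrite -(val_quo x). Qed.

Definition quo0 : Y := quo 0.
Definition quoA (x y : Y) : Y := quo (val x + val y).
Definition quoO (x : Y) : Y := quo (- val x).
Definition quoS (x : Y) (a : R) : Y := quo (val x ** a).

Lemma quoAE x y : quoA (quo x) (quo y) = quo (x + y).
Proof.
by apply/eqP; rewrite quo_eq opprD addrACA submodD ?coset_reprP.
Qed.

Lemma quoOE x : quoO (quo x) = quo (- x).
Proof. by apply/eqP; rewrite quo_eq -opprD submodN ?coset_reprP. Qed.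

Lemma quoSE x a : quoS (quo x) a = quo (x ** a).
Proof. by apply/eqP; rewrite quo_eq -ractsNl -ractsDl submodZ ?coset_reprP. Qed.

Fact quoA_assoc : associative quoA.
Proof.
by elim/quo_ind=> x; elim/quo_ind=> y; elim/quo_ind=> z; rewrite !quoAE addrA.
Qed.
Fact quoA_comm : commutative quoA.
Proof. by elim/quo_ind=> x; elim/quo_ind=> y; rewrite !quoAE addrC. Qed.
Fact quo_add0 : left_id quo0 quoA.
Proof. by elim/quo_ind=> x; rewrite quoAE add0r. Qed.
Fact quo_addN : left_inverse quo0 quoO quoA.
Proof. by elim/quo_ind=> x; rewrite quoOE quoAE addNr. Qed.
HB.instance Definition _ :=
  GRing.isZmodule.Build Y quoA_assoc quoA_comm quo_add0 quo_addN.

Fact quo_ractsA x a b : quoS x (a * b) = quoS (quoS x a) b.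
Proof. by elim/quo_ind: x => x; rewrite !quoSE ractsA. Qed.
Fact quo_racts1 x : quoS x 1 = x.
Proof. by elim/quo_ind: x => x; rewrite quoSE racts1. Qed.
Fact quo_ractsDl x y a : quoS (x + y) a = quoS x a + quoS y a.
Proof.
elim/quo_ind: x => x; elim/quo_ind: y => y.
by rewrite [_ + _ in LHS]quoAE !quoSE ractsDl [RHS]quoAE.
Qed.
Fact quo_ractsDr x a b : quoS x (a + b) = quoS x a + quoS x b.
Proof. by elim/quo_ind: x => x; rewrite !quoSE ractsDr [RHS]quoAE. Qed.
HB.instance Definition _ :=
  isRightModule.Build R Y quo_ractsA quo_racts1 quo_ractsDl quo_ractsDr.

Fact quo_linear : rlinear quo.
Proof. by move=> a x y; rewrite -quoAE -quoSE. Qed.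

End QuotientModule.

Lemma quotient_exists A : submod A ->
  exists (Y : finRmod R) (q : T -> Y),
    [/\ rlinear q, forall x y, (q x == q y) = (coset_repr A x == coset_repr A y)
      & A != [set 0] -> (#|Y| < #|T|)%N].
Proof.
move=> HA; exists (quom HA), (@quo A HA); split; first exact: quo_linear.
  by move=> x y; rewrite quo_eq // coset_repr_eq.
move=> An0; rewrite ltn_neqAle; apply/andP; split; last first.
  exact: (leq_card (val : quom HA -> T) val_inj).
(* With equal cardinals the surjection onto the quotient is injective, which forces A to be zero. *)
apply: contra An0 => /eqP YT; rewrite eqEsubset sub1set (submod0 HA) andbT.
apply/subsetP=> t tA; rewrite inE.
have codq : codom (quo HA) =i predT.
  by elim/quo_ind=> y; rewrite codom_f.
have /image_injP qinj : #|image (quo HA) T| == #|T|.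
  by rewrite -YT; apply/eqP/eq_card.
by apply/eqP/qinj => //; apply/eqP; rewrite quo_eq subr0.
Qed.

End Submodules.

(** * Matrices acting on tuples *)

Section TupleAction.
Variable R : finPzRingType.
Implicit Types T U : finRmod R.

(** The product xA of a row with entries in T by a matrix; it is the functoriality of n |-> T^n,
    that is, of T ⊗ R^n. *)
Definition mact T n m (A : 'M[R]_(n, m)) (x : {ffun 'I_n -> T}) : {ffun 'I_m -> T} :=
  [ffun j => \sum_i x i ** A i j].

Definition hmap T U (h : T -> U) n (x : {ffun 'I_n -> T}) : {ffun 'I_n -> U} :=
  [ffun i => h (x i)].

Lemma mact_hmap T U (h : T -> U) : rlinear h ->
  forall n m (A : 'M[R]_(n, m)) x, mact A (hmap h x) = hmap h (mact A x).
Proof.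
move=> hl n m A x; apply/ffunP=> j; rewrite !ffunE (rlinear_sum hl).
by apply: eq_bigr => i _; rewrite ffunE (rlinearZ hl).
Qed.

Lemma mactDm T n m (A B : 'M[R]_(n, m)) (x : {ffun 'I_n -> T}) :
  mact (A + B) x = mact A x + mact B x.
Proof.
apply/ffunP=> j; rewrite !ffunE -big_split /=.
by apply: eq_bigr => i _; rewrite mxE ractsDr.
Qed.

Variable T : finRmod R.

Definition spn n (x : {ffun 'I_n -> T}) : {set T} :=
  [set \sum_i x i ** c i | c : {ffun 'I_n -> R}].

Lemma spn_submod n (x : {ffun 'I_n -> T}) : submod (spn x).
Proof.
apply/submodP; split.
  apply/imsetP; exists [ffun=> 0] => //.
  by rewrite big1 // => i _; rewrite ffunE racts0r.
move=> a _ _ /imsetP[c _ ->] /imsetP[d _ ->].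
apply/imsetP; exists [ffun i => c i * a + d i] => //.
rewrite racts_suml -big_split /=; apply: eq_bigr => i _.
by rewrite ffunE ractsDr ractsA.
Qed.

Lemma mem_spn n (x : {ffun 'I_n -> T}) i : x i \in spn x.
Proof.
apply/imsetP; exists [ffun j => (j == i)%:R] => //.
rewrite (bigD1 i) //= ffunE eqxx racts1 big1 ?addr0 // => j /negPf ji.
by rewrite ffunE ji racts0r.
Qed.

Lemma spn_sub n (x : {ffun 'I_n -> T}) (A : {set T}) : submod A ->
  (spn x \subset A) = [forall i, x i \in A].
Proof.
move=> HA; apply/idP/forallP=> [/subsetP sA i|xA]; first exact/sA/mem_spn.
apply/subsetP=> _ /imsetP[c _ ->].
by apply: submod_sum => // i; rewrite submodZ.
Qed.

Definition gen n (x : {ffun 'I_n -> T}) : bool := spn x == setT.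

Lemma gen_mact n m (x : {ffun 'I_n -> T}) (z : {ffun 'I_m -> T}) : gen x ->
  exists A, mact A x = z.
Proof.
move=> /eqP gx.
have ex j : exists c : {ffun 'I_n -> R}, \sum_i x i ** c i == z j.
  have : z j \in spn x by rewrite gx inE.
  by case/imsetP=> c _ ->; exists c.
exists (\matrix_(i, j) xchoose (ex j) i); apply/ffunP=> j.
rewrite ffunE -[RHS](eqP (xchooseP (ex j))).
by apply: eq_bigr => i _; rewrite mxE.
Qed.

(** The map A |-> xA is additive, and onto since x generates, so its fibres are translates of its
    kernel. *)
Lemma card_fiber n m (x : {ffun 'I_n -> T}) (z : {ffun 'I_m -> T}) : gen x ->
  #|[set A | mact A x == z]| = #|[set A : 'M[R]_(n, m) | mact A x == 0]|.
Proof.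
move=> gx; have [A1 A1z] := gen_mact z gx.
rewrite -[RHS](card_imset _ (addIr A1)); apply/esym/eq_card => B.
apply/imsetP/idP=> [[A]|]; rewrite ?inE.
  by move=> /eqP A0 ->; rewrite mactDm A0 add0r A1z.
move=> /eqP Bz; exists (B - A1); rewrite ?subrK // inE.
by apply/eqP/(addIr z); rewrite add0r -{1}A1z -mactDm subrK.
Qed.

(** Source of all powers of p: when |R| is one, both |T| and the size of the kernel divide a power
    of p. *)
Lemma card_fiberM n m (x : {ffun 'I_n -> T}) : gen x ->
  (#|[set A : 'M[R]_(n, m) | mact A x == 0%R]| * #|T| ^ m = #|R| ^ (n * m))%N.
Proof.
move=> gx; rewrite -card_mx -[RHS]sum1_card [RHS](partition_big (fun A => mact A x) predT) //=.
rewrite [RHS](eq_bigr (fun=> #|[set A : 'M[R]_(n, m) | mact A x == 0]|)).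
  by rewrite sum_nat_const mulnC card_ffun card_ord.
by move=> z _; rewrite -(card_fiber z gx) sum1_card; apply: eq_card => A; rewrite !inE.
Qed.

Lemma gen_exists : exists n, exists x : {ffun 'I_n -> T}, gen x.
Proof.
exists #|T|, [ffun i => enum_val i]; apply/eqP/setP=> t; rewrite inE.
have := mem_spn [ffun i : 'I_#|T| => enum_val i] (enum_rank t).
by rewrite ffunE enum_rankK.
Qed.

Lemma card_rmod_pow p : prime p -> (exists e, #|R| = (p ^ e)%N) ->
  exists j, #|T| = (p ^ j)%N.
Proof.
move=> pp [e Re]; have [n [x gx]] := gen_exists.
have := card_fiberM 1 gx; rewrite expn1 Re -expnM => E.
have : (#|T| %| p ^ (e * (n * 1)))%N by rewrite -E dvdn_mull.
by case/(dvdn_pfactor _ _ pp)=> j _ ->; exists j.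
Qed.

Lemma card_fiber_pow p n m (x : {ffun 'I_n -> T}) : gen x ->
  prime p -> (exists e, #|R| = (p ^ e)%N) ->
  exists j, #|[set A : 'M[R]_(n, m) | mact A x == 0%R]| = (p ^ j)%N.
Proof.
move=> gx pp [e Re].
have := card_fiberM m gx; rewrite Re -expnM => E.
have : (#|[set A : 'M[R]_(n, m) | mact A x == 0%R]| %| p ^ (e * (n * m)))%N.
  by rewrite -E dvdn_mulr.
by case/(dvdn_pfactor _ _ pp)=> j _ ->; exists j.
Qed.

End TupleAction.

(** * Automorphisms of T and their free action on generating tuples *)

Section Automorphisms.
Variables (R : finPzRingType) (T : finRmod R).

Definition auts : {set {perm T}} :=
  [set g : {perm T} | [forall a : R, forall x, forall y, g (x ** a + y) == g x ** a + g y]].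

Lemma autsP (g : {perm T}) : reflect (rlinear (R := R) g) (g \in auts).
Proof.
rewrite inE; apply: (iffP idP) => [gl a x y|gl].
  by move/forallP/(_ a)/forallP/(_ x)/forallP/(_ y)/eqP: gl.
by apply/forallP=> a; apply/forallP=> x; apply/forallP=> y; apply/eqP.
Qed.

Lemma auts_group_set : group_set auts.
Proof.
apply/group_setP; split; first by apply/autsP=> a x y; rewrite !perm1.
by move=> g h /autsP gl /autsP hl; apply/autsP=> a x y; rewrite !permM gl hl.
Qed.
Canonical auts_group := group auts_group_set.

(* A right action: permutations are composed from left to right. *)
Definition tact n (x : {ffun 'I_n -> T}) (g : {perm T}) := hmap g x.

Lemma tact1 n (x : {ffun 'I_n -> T}) : tact x 1%g = x.
Proof. by apply/ffunP=> i; rewrite ffunE perm1. Qed.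

Lemma tactM n (x : {ffun 'I_n -> T}) g h : tact x (g * h)%g = tact (tact x g) h.
Proof. by apply/ffunP=> i; rewrite !ffunE permM. Qed.

Lemma tactK n g : cancel (fun x : {ffun 'I_n -> T} => tact x g) (fun x => tact x g^-1%g).
Proof. by move=> x; rewrite -tactM mulgV tact1. Qed.

Lemma tactVK n g : cancel (fun x : {ffun 'I_n -> T} => tact x g^-1%g) (fun x => tact x g).
Proof. by move=> x; rewrite -tactM mulVg tact1. Qed.

Lemma mact_tact n m (A : 'M[R]_(n, m)) x g : g \in auts ->
  mact A (tact x g) = tact (mact A x) g.
Proof. by move=> /autsP gl; apply: mact_hmap. Qed.

Lemma spn_tact n (x : {ffun 'I_n -> T}) g : g \in auts ->
  spn (tact x g) = [set g t | t in spn x].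
Proof.
move=> /autsP gl; rewrite /spn -imset_comp; apply: eq_imset => c /=.
by rewrite (rlinear_sum gl); apply: eq_bigr => i _; rewrite ffunE (rlinearZ gl).
Qed.

Lemma gen_tact n (x : {ffun 'I_n -> T}) g : g \in auts -> gen (tact x g) = gen x.
Proof.
move=> gG; have sub h y : h \in auts -> gen y -> gen (tact (n := n) y h).
  move=> hG /eqP gy; rewrite /gen spn_tact // gy; apply/eqP/setP=> t.
  by rewrite inE; apply/imsetP; exists (h^-1%g t); rewrite ?inE ?permKV.
apply/idP/idP; last exact: sub.
by rewrite -{2}(tactK g x); apply: sub; rewrite groupV.
Qed.

Lemma tact_inj n (x : {ffun 'I_n -> T}) : gen x ->
  {in auts &, injective (tact x)}.
Proof.
move=> /eqP gx g h /autsP gl /autsP hl e; apply/permP=> t.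
have /imsetP[c _ ->] : t \in spn x by rewrite gx inE.
rewrite (rlinear_sum gl) (rlinear_sum hl); apply: eq_bigr => i _.
rewrite (rlinearZ gl) (rlinearZ hl).
by have /ffunP/(_ i) := e; rewrite !ffunE => ->.
Qed.

(** The relations of y hold for x, so y_i |-> x_i extends to a linear map from the span of y onto T.
    As T is finite, that span is all of T and the map is an automorphism. *)
Lemma tact_orbit n (x y : {ffun 'I_n -> T}) : gen x ->
  (forall c : {ffun 'I_n -> R}, \sum_i y i ** c i = 0 -> \sum_i x i ** c i = 0) ->
  exists2 g, g \in auts & y = tact x g.
Proof.
move=> gx xy.
have ex t : exists c : {ffun 'I_n -> R}, \sum_i x i ** c i == t.
  have : t \in spn x by rewrite (eqP gx) inE.
  by case/imsetP=> c _ ->; exists c.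
pose co t := xchoose (ex t).
have coE t : \sum_i x i ** co t i = t by apply/eqP/(xchooseP (ex t)).
have xy2 (c d : {ffun 'I_n -> R}) : \sum_i y i ** c i = \sum_i y i ** d i ->
    \sum_i x i ** c i = \sum_i x i ** d i.
  move=> e; apply/eqP; rewrite -subr_eq0.
  have E (z : {ffun 'I_n -> T}) :
      \sum_i z i ** c i - \sum_i z i ** d i = \sum_i z i ** [ffun i => c i - d i] i.
    rewrite -(ractsN1 (R := R)) racts_suml -big_split /=; apply: eq_bigr => i _.
    by rewrite ffunE ractsDr -ractsA mulrN1.
  by rewrite E xy // -E e subrr.
(* The coordinates [co t] are arbitrary choices, so f is not visibly linear. It is injective, hence
   bijective, and linearity is read off its inverse, which sends each combination of y to the same
   combination of x. *)
pose f t := \sum_i y i ** co t i.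
have finj : injective f.
  by move=> s t /xy2; rewrite !coE.
have fbij := injF_bij finj; have [f' fK f'K] := fbij.
have f'E (c : {ffun 'I_n -> R}) : f' (\sum_i y i ** c i) = \sum_i x i ** c i.
  by rewrite -[LHS]coE; apply: xy2; rewrite -[LHS]/(f _) f'K.
have f'S t : exists c : {ffun 'I_n -> R}, t = \sum_i y i ** c i.
  by exists (co (f' t)); rewrite -[RHS]/(f _) f'K.
have f'l : rlinear (R := R) f'.
  move=> a s t; have [c ->] := f'S s; have [d ->] := f'S t.
  have E (z : {ffun 'I_n -> T}) : (\sum_i z i ** c i) ** a + \sum_i z i ** d i =
      \sum_i z i ** [ffun i => c i * a + d i] i.
    rewrite racts_suml -big_split /=; apply: eq_bigr => i _.
    by rewrite ffunE ractsDr ractsA.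
  by rewrite E !f'E -E.
pose g := perm finj.
have gl : g^-1%g \in auts.
  apply/autsP=> a s t; apply: (@perm_inj _ g).
  have gf z : g z = f z by rewrite permE.
  rewrite permKV; have gV z : g^-1%g z = f' z.
    by apply: (@perm_inj _ g); rewrite permKV gf f'K.
  by rewrite !gV -f'l gf f'K.
exists g; first by rewrite -groupV.
apply/ffunP=> i; rewrite ffunE permE.
apply: (canRL f'K).
have D (z : {ffun 'I_n -> T}) : z i = \sum_j z j ** [ffun j => (j == i)%:R : R] j.
  rewrite (bigD1 i) //= ffunE eqxx racts1 big1 ?addr0 // => j /negPf ji.
  by rewrite ffunE ji racts0r.
by rewrite (D y) f'E -(D x).
Qed.

End Automorphisms.

(** * The key identity *)

Section Counting.
Variables (R : finPzRingType) (p : nat).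
Hypotheses (pp : prime p) (Rp : exists e, #|R| = (p ^ e)%N).
Variable T : finRmod R.

Lemma card_submod_pow (A : {set T}) : submod A -> exists j, #|A| = (p ^ j)%N.
Proof.
move=> HA; have [Y [_ [_ _ _ <-]]] := submodule_exists HA.
exact: card_rmod_pow.
Qed.

Lemma card_spn_sub n (A : {set T}) : submod A ->
  #|[set x : {ffun 'I_n -> T} | spn x \subset A]| = (#|A| ^ n)%N.
Proof.
move=> HA; rewrite -[n in RHS]card_ord -card_ffun_on.
apply: eq_card => x; by rewrite inE spn_sub.
Qed.

(** Sort the |A|^n tuples with entries in A by the submodule they span. The proper submodules are
    covered by induction, and |A| is a power of p. *)
Lemma polyfun_card_spn (A : {set T}) : submod A ->
  polyfun p (fun n => #|[set x : {ffun 'I_n -> T} | spn x == A]|%:R).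
Proof.
have [c] := ubnP #|A|; elim: c A => // c IH A /ltnSE leA HA.
pose f (B : {set T}) n : rat := #|[set x : {ffun 'I_n -> T} | spn x == B]|%:R.
have h1 : polyfun p (fun n => \sum_(B | submod B && (B \proper A)) f B n).
  apply: polyfun_sum => B /andP[HB BA]; apply: IH => //.
  exact: leq_trans (proper_card BA) leA.
have [j Aj] := card_submod_pow HA.
apply: eq_polyfun (polyfunB (polyfun_exp Aj) h1) => n.
rewrite -card_spn_sub // -sum1_card.
rewrite (partition_big (fun x => spn x) (fun B => submod B && (B \subset A))) /=; last first.
  by move=> x; rewrite inE spn_submod.
rewrite (bigD1 A) /= ?HA ?subxx // natrD.
have E B : submod B -> B \subset A ->
    (\sum_(x in [set x : {ffun 'I_n -> T} | spn x \subset A] | spn x == B) 1)%N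
    = #|[set x : {ffun 'I_n -> T} | spn x == B]|.
  move=> HB BA; rewrite sum1_card; apply: eq_card => x.
  by rewrite !inE unfold_in /= inE; apply: andb_idl => /eqP->.
rewrite E // natr_sum -addrA [X in _ + X](_ : _ = 0) ?addr0 //.
apply/eqP; rewrite subr_eq0; apply/eqP; apply: eq_big => [B|B /andP[/andP[HB BA] _]].
  by rewrite -andbA properEneq [(B != A) && _]andbC.
by rewrite E.
Qed.

Lemma polyfun_card_gen : polyfun p (fun n => #|[set x : {ffun 'I_n -> T} | gen x]|%:R).
Proof.
apply: polyfun_card_spn; apply/submodP; split; first by rewrite inE.
by move=> *; rewrite inE.
Qed.

End Counting.

Section KeySum.
Variables (k : fieldType) (R : finPzRingType) (T : finRmod R).

(** The obstruction to y_i |-> x_i being a well-defined linear map. *)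
Definition kerimage n (x y : {ffun 'I_n -> T}) : {set T} :=
  [set \sum_i x i ** c i | c : {ffun 'I_n -> R} in [set c : {ffun 'I_n -> R} | \sum_i y i ** c i == 0]].

Lemma kerimage_submod n (x y : {ffun 'I_n -> T}) : submod (kerimage x y).
Proof.
have E (a : R) (c d : {ffun 'I_n -> R}) (z : {ffun 'I_n -> T}) :
    \sum_i z i ** [ffun i => c i * a + d i] i =
    (\sum_i z i ** c i) ** a + \sum_i z i ** d i.
  rewrite racts_suml -big_split /=; apply: eq_bigr => i _.
  by rewrite ffunE ractsDr ractsA.
apply/submodP; split.
  apply/imsetP; exists [ffun=> 0]; rewrite ?inE ?big1 // => i _;
  by rewrite ffunE racts0r.
move=> a _ _ /imsetP[c + ->] /imsetP[d + ->]; rewrite !inE => /eqP c0 /eqP d0.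
apply/imsetP; exists [ffun i => c i * a + d i]; last by rewrite E.
by rewrite inE E c0 d0 racts0l addr0.
Qed.

Lemma kerimage_tuple n m (x y : {ffun 'I_n -> T}) (v : {ffun 'I_m -> T}) :
  (forall j, v j \in kerimage x y) ->
  exists A : 'M[R]_(n, m), mact A x = v /\ mact A y = 0.
Proof.
move=> vB.
have ex j : exists c : {ffun 'I_n -> R},
    (\sum_i y i ** c i == 0) && (\sum_i x i ** c i == v j).
  by have /imsetP[c] := vB j; rewrite inE => c0 ->; exists c; rewrite c0 eqxx.
have exE j := andP (xchooseP (ex j)).
exists (\matrix_(i, j) xchoose (ex j) i); split; apply/ffunP=> j; rewrite !ffunE.
  by have [_ /eqP e] := exE j; rewrite -[RHS]e; apply: eq_bigr => i _; rewrite mxE.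
by have [/eqP e _] := exE j; rewrite -[RHS]e; apply: eq_bigr => i _; rewrite mxE.
Qed.

(** Says that w dies in k[(T/B)^m] for every nonzero submodule B, i.e. that w lies in I. *)
Definition coset_free m (w : {ffun 'I_m -> T} -> k) : Prop :=
  forall B : {set T}, submod B -> B != [set 0] ->
  forall v, \sum_(v' | hmap (coset_repr B) v' == v) w v' = 0.

(* The fibre of A |-> yA over z is invariant under the A0 with y A0 = 0, whose *)
(* values x A0 fill B^m for B := kerimage x y; if B = 0 then y lies in the      *)
(* orbit of x, otherwise w sums to 0 over the cosets of B^m.                    *)
Lemma sum_mact_off_orbit n m (x y : {ffun 'I_n -> T}) (z : {ffun 'I_m -> T}) w :
  gen x -> (forall g, g \in auts T -> y != tact x g) -> coset_free w ->
  \sum_(A : 'M[R]_(n, m) | mact A y == z) w (mact A x) = 0.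
Proof.
move=> gx yx fw; pose B := kerimage x y; have HB : submod B by exact: kerimage_submod.
have Bn0 : B != [set 0].
  apply/eqP=> B0.
  have [c c0|g gG yE] := @tact_orbit _ _ _ x y gx.
    have : \sum_i x i ** c i \in B by apply/imsetP; exists c; rewrite // inE c0.
    by rewrite B0 inE => /eqP.
  by have := yx g gG; rewrite yE eqxx.
pose N v := #|[set A : 'M[R]_(n, m) | (mact A y == z) && (mact A x == v)]|.
pose F (v : {ffun 'I_m -> T}) := hmap (coset_repr B) v.
have NF v v0 : F v = F v0 -> N v = N v0.
  move=> Fv; have [|A0 [A0x A0y]] := @kerimage_tuple n m x y (v0 - v).
    move=> j; have /ffunP/(_ j)/esym/eqP := Fv; rewrite !ffunE.
    by rewrite coset_repr_eq.
  rewrite /N -(card_imset _ (addIr A0)); apply: eq_card => A.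
  apply/imsetP/idP=> [[A']|]; rewrite !inE => /andP[/eqP Ay /eqP Ax].
    by move=> ->; rewrite !mactDm Ay Ax A0x A0y addr0 addrC subrK !eqxx.
  exists (A - A0); rewrite ?subrK // inE.
  have -> : mact (A - A0) y = mact A y.
    by apply: (addIr (mact A0 y)); rewrite -mactDm subrK A0y addr0.
  have -> : mact (A - A0) x = mact A x - (v0 - v).
    by apply: (addIr (mact A0 x)); rewrite -mactDm subrK A0x subrK.
  by rewrite Ay Ax opprB addrC subrK !eqxx.
rewrite (partition_big (fun A => mact A x) predT) //=.
rewrite (eq_bigr (fun v => w v *+ N v)); last first.
  move=> v _; rewrite (eq_bigr (fun=> w v)) => [|A /andP[_ /eqP->]//].
  by rewrite sumr_const; congr (_ *+ _); apply: eq_card => A; rewrite !inE.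
rewrite (partition_big F predT) //= big1 // => b _.
have [v0 /eqP Fv0|F0] := pickP (fun v => F v == b); last by rewrite big_pred0.
rewrite (eq_bigr (fun v => w v *+ N v0)); last first.
  by move=> v /eqP Fv; rewrite (NF v v0) // Fv.
by rewrite sumrMnl fw ?mul0rn.
Qed.

(** Since (gx)A = z means xA = g^-1 z, the summand is constant on a fibre whose size is that of the
    kernel. *)
Lemma sum_mact_orbit n m (x : {ffun 'I_n -> T}) (z : {ffun 'I_m -> T}) w g :
  gen x -> g \in auts T ->
  \sum_(A : 'M[R]_(n, m) | mact A (tact x g) == z) w (mact A x) =
  w (tact z g^-1%g) *+ #|[set A : 'M[R]_(n, m) | mact A x == 0]| :> k.
Proof.
move=> gx gG.
have E A : (mact A (tact x g) == z) = (mact A x == tact z g^-1%g).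
  rewrite mact_tact //; apply/eqP/eqP=> [<-|->]; first by rewrite tactK.
  by rewrite tactVK.
rewrite (eq_bigl _ _ E) (eq_bigr (fun=> w (tact z g^-1%g))) => [|A /eqP->//].
rewrite sumr_const -(card_fiber (tact z g^-1%g) gx); congr (_ *+ _).
by apply: eq_card => A; rewrite !inE.
Qed.

(** The coefficient at z of the key identity. After exchanging sums, each y outside the orbit of x
    has weight 0, and freeness indexes the orbit by the automorphisms. *)
Lemma sum_mact n m (x : {ffun 'I_n -> T}) (z : {ffun 'I_m -> T})
    (w : {ffun 'I_m -> T} -> k) (u : {ffun 'I_n -> T} -> k) :
  gen x -> coset_free w ->
  \sum_(A : 'M[R]_(n, m)) w (mact A x) * (\sum_(y | mact A y == z) u y) =
  (\sum_(g in auts T) u (tact x g) * w (tact z g^-1%g)) *+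
    #|[set A : 'M[R]_(n, m) | mact A x == 0]|.
Proof.
move=> gx fw.
transitivity (\sum_y u y * \sum_(A : 'M[R]_(n, m) | mact A y == z) w (mact A x)).
  under eq_bigr do rewrite mulr_sumr.
  under [RHS]eq_bigr do rewrite mulr_sumr.
  rewrite (exchange_big_dep predT) //=; apply: eq_bigr => y _.
  by apply: eq_bigr => A _; rewrite mulrC.
rewrite (bigID (fun y => y \in [set tact x g | g in auts T])) /= addrC big1 ?add0r.
  rewrite big_imset /=; last exact: tact_inj.
  by rewrite -sumrMnl; apply: eq_bigr => g gG; rewrite sum_mact_orbit // mulrnAr.
move=> y yx; rewrite sum_mact_off_orbit ?mulr0 // => g gG.
by apply: contra yx => /eqP->; apply: imset_f.
Qed.

End KeySum.

(** * The functors k[T^n] *)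

Section VspaceOfPredicate.
Variables (k : fieldType) (V : vectType k) (P : V -> Prop).

(** Take U of maximal dimension among the subspaces contained in P; a vector of P outside U would
    enlarge it. *)
Lemma vspace_of_pred : P 0 -> (forall a u v, P u -> P v -> P (a *: u + v)) ->
  exists U : {vspace V}, forall v, v \in U <-> P v.
Proof.
move=> P0 PZD.
pose Q d := `[< exists2 U : {vspace V}, forall v, v \in U -> P v & \dim U = d >].
have exQ : exists d, Q d.
  by exists 0%N; apply/asboolP; exists 0%VS; rewrite ?dimv0 // => v; rewrite memv0 => /eqP->.
have leQ d : Q d -> (d <= \dim {:V})%N.
  by move/asboolP=> [U _ <-]; apply/dimvS/subvf.
case: (ex_maxnP exQ leQ) => d /asboolP[U UP dU] dmax.
exists U => v; split=> [/UP//|Pv]; apply/negPn/negP=> vU.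
have /dmax : Q (\dim (<[v]> + U)); last first.
  rewrite -dU leqNgt => /negP; apply; rewrite ltn_neqAle dimvS ?addvSr // andbT.
  apply: contra vU => /eqP e; have : U == (<[v]> + U)%VS by rewrite eqEdim addvSr e leqnn.
  by move/eqP->; apply: (subvP (addvSl _ _)); apply: memv_line.
apply/asboolP; exists (<[v]> + U)%VS => // w /memv_addP[_ /vlineP[a ->] [u uU ->]].
by apply: PZD => //; apply: UP.
Qed.

End VspaceOfPredicate.

Section DirectSum.
Variables (k : fieldType) (V : vectType k) (I : finType).

Definition single_fun (i : I) (v : V) : {ffun I -> V} :=
  [ffun j => if j == i then v else 0].

Lemma single_linear i : linear (single_fun i).
Proof.
move=> a u v; apply/ffunP=> j; rewrite !ffunE.
by case: ifP => // _; rewrite scaler0 addr0.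
Qed.
HB.instance Definition _ i :=
  GRing.isLinear.Build k V {ffun I -> V} _ (single_fun i) (single_linear i).

Definition single i : 'Hom(V, {ffun I -> V}) := linfun (single_fun i).

Lemma singleE i v j : single i v j = if j == i then v else 0.
Proof. by rewrite lfunE ffunE. Qed.

Lemma dim_sum_single (X : {set I}) (M : {vspace V}) :
  \dim (\sum_(i in X) single i @: M) = (#|X| * \dim M)%N.
Proof.
have dir : directv (\sum_(i in X) single i @: M).
  apply/directv_sum_independent => us usM us0 i iX.
  have /ffunP/(_ i) := us0; rewrite sum_ffunE ffunE (bigD1 i) //= big1 ?addr0.
    have /memv_imgP[v _ ->] := usM i iX; rewrite singleE eqxx => ->.
    by rewrite linear0.
  move=> j /andP[jX ji]; have /memv_imgP[v _ ->] := usM j jX.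
  by rewrite singleE eq_sym (negPf ji).
rewrite (directvP dir) /= -sum_nat_const; apply: eq_bigr => i _.
apply: limg_dim_eq; apply/eqP; rewrite -subv0; apply/subvP=> v.
rewrite memv_cap memv_ker memv0 => /andP[_ /eqP/ffunP/(_ i)].
by rewrite singleE eqxx ffunE => ->.
Qed.

End DirectSum.

Section PushForward.
Variable k : fieldType.

Section Def.
Variables (I J : finType) (F : I -> J).

(** The linear map k[I] -> k[J] induced by F, with k[I] encoded as functions on the finite set I. *)
Definition push_fun (u : {ffun I -> k^o}) : {ffun J -> k^o} :=
  [ffun y => \sum_(x | F x == y) u x].

Lemma push_linear : linear push_fun.
Proof.
move=> a u v; apply/ffunP=> y; rewrite !ffunE scaler_sumr -big_split /=.
by apply: eq_bigr => x _; rewrite !ffunE.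
Qed.
HB.instance Definition _ :=
  GRing.isLinear.Build k {ffun I -> k^o} {ffun J -> k^o} _ push_fun push_linear.

Definition push : 'Hom({ffun I -> k^o}, {ffun J -> k^o}) := linfun push_fun.

Lemma pushE u y : push u y = \sum_(x | F x == y) u x.
Proof. by rewrite lfunE ffunE. Qed.

Lemma mem_lker_push (u : {ffun I -> k^o}) :
  reflect (forall y, \sum_(x | F x == y) u x = 0) (u \in lker push).
Proof.
rewrite memv_ker; apply: (iffP eqP) => [/ffunP e y|e].
  by have := e y; rewrite pushE ffunE.
by apply/ffunP=> y; rewrite pushE ffunE e.
Qed.

End Def.

Definition delta (I : finType) (x : I) : {ffun I -> k^o} := [ffun y => (y == x)%:R].

Lemma ffun_delta (I : finType) (u : {ffun I -> k^o}) : u = \sum_x u x *: delta x.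
Proof.
apply/ffunP=> y; rewrite sum_ffunE (bigD1 y) //= big1 => [|x /negPf xy].
  by rewrite addr0 !ffunE eqxx /= [_ *: _]mulr1.
by rewrite !ffunE eq_sym xy /= [_ *: _]mulr0.
Qed.

Lemma push_delta (I J : finType) (F : I -> J) x : push F (delta x) = delta (F x).
Proof.
apply/ffunP=> y; rewrite pushE ffunE.
under eq_bigr do rewrite ffunE.
rewrite -natr_sum; congr _%:R; case: eqP => [->|yx].
  rewrite (bigD1 x) //= eqxx big1 // => z /andP[_ /negPf->]//.
by rewrite big1 // => z /eqP Fz; case: eqP => // zx; case: yx; rewrite -zx.
Qed.

Lemma push_comp (I J L : finType) (F : I -> J) (G : J -> L) u :
  push G (push F u) = push (G \o F) u.
Proof.
rewrite [u]ffun_delta !linear_sum; apply: eq_bigr => x _.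
by rewrite !linearZ /= !push_delta.
Qed.

Lemma eq_push (I J : finType) (F G : I -> J) : F =1 G -> push F =1 push G.
Proof.
move=> FG u; apply/ffunP=> y; rewrite !pushE.
by apply: eq_bigl => x; rewrite FG.
Qed.

Lemma mem_limg_push (I J : finType) (F : I -> J) (u : {ffun J -> k^o}) :
  reflect (forall y, y \notin codom F -> u y = 0) (u \in limg (push F)).
Proof.
apply: (iffP idP) => [/memv_imgP[v _ ->] y yF|u0].
  rewrite pushE big_pred0 // => x; apply/negbTE; apply: contra yF => /eqP<-.
  exact: codom_f.
rewrite [u]ffun_delta; apply: memv_suml => y _.
have [/codomP[x ->]|/u0->] := boolP (y \in codom F); last by rewrite scale0r mem0v.
by rewrite memvZ // -push_delta memv_img ?memvf.
Qed.

(** The kernel depends only on the partition of I into fibres; this is what allows [coset_repr] to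
    stand for a quotient map. *)
Lemma lker_push_eq (I J J' : finType) (F : I -> J) (F' : I -> J') :
  (forall x y, (F x == F y) = (F' x == F' y)) ->
  lker (push F) = lker (push F').
Proof.
move=> FF'.
have sub (L L' : finType) (G : I -> L) (G' : I -> L') (u : {ffun I -> k^o}) :
    (forall x y, (G x == G y) = (G' x == G' y)) ->
    u \in lker (push G) -> u \in lker (push G').
  move=> GG' /mem_lker_push u0; apply/mem_lker_push => y.
  have [x0 /eqP <-|ny] := pickP (fun x => G' x == y); last by rewrite big_pred0.
  by rewrite -[RHS](u0 (G x0)); apply: eq_bigl => x; rewrite GG'.
by apply/vspaceP=> u; apply/idP/idP; apply: sub.
Qed.

End PushForward.

Section TupleRep.
Variables (k : fieldType) (R : finPzRingType).

Definition tuprep (T : finRmod R) : vrep k (fun n m => 'M[R]_(n, m)) :=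
  VRep (fun n m (A : 'M[R]_(n, m)) => push k (mact (T := T) A)).

Lemma natural_hmap (T U : finRmod R) (h : T -> U) : rlinear h ->
  @natural _ _ (tuprep T) (tuprep U) (fun n => push k (@hmap R T U h n)).
Proof.
move=> hl n m A u; rewrite /= !push_comp; apply: eq_push => x /=.
by rewrite mact_hmap.
Qed.

End TupleRep.

Section Goodness.
Variables (k : fieldType) (R : finPzRingType) (p : nat).
Variable T : finRmod R.
Local Notation P := (tuprep k T).
Local Notation tup n := {ffun 'I_n -> T}.
Hypothesis IH : forall Y : finRmod R, (#|Y| < #|T|)%N -> good p (tuprep k Y).

(* The tuples in A, written as the image of a (nonlinear) retraction of T^n. *)
Definition Jsp (A : {set T}) n : {vspace P n} :=
  limg (push k (@hmap R T T (fun t => if t \in A then t else 0) n)).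

Lemma mem_Jsp (A : {set T}) n (u : P n) : submod A ->
  reflect (forall x : tup n, ~~ (spn x \subset A) -> u x = 0) (u \in Jsp A n).
Proof.
move=> HA; have E (x : tup n) :
  (x \in codom (@hmap R T T (fun t => if t \in A then t else 0) n)) = (spn x \subset A).
  rewrite spn_sub //; apply/idP/forallP=> [/codomP[y ->] i|xA].
    by rewrite ffunE; case: ifP => // _; apply: submod0.
  apply/codomP; exists x; apply/ffunP=> i; by rewrite ffunE xA.
apply: (iffP (mem_limg_push _ _)) => h x; last by rewrite E; apply: h.
by rewrite -E; apply: h.
Qed.

(* [coset_repr B] has the same fibres as T -> T / B. *)
Definition Isp (B : {set T}) n : {vspace P n} :=
  lker (push k (@hmap R T T (coset_repr B) n)).

Lemma good_Jsp A : submod A && (A != setT) -> good_image p (Jsp A).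
Proof.
move=> /andP[HA AT]; have [Y [j [jl jinj jA Yc]]] := submodule_exists HA.
exists (tuprep k Y), (fun n => push k (@hmap R Y T j n)); split.
- apply: IH; rewrite Yc -cardsT; apply: proper_card.
  by rewrite properEneq AT subsetT.
- exact: natural_hmap.
move=> n; apply/vspaceP=> u; apply/idP/idP=> [/(mem_Jsp _ HA) h|/mem_limg_push h].
  apply/mem_limg_push=> x xY; apply: h; apply: contra xY; rewrite spn_sub //.
  move=> /forallP xA.
  have ex i : exists y, j y == x i by have /jA[y /eqP yx] := xA i; exists y.
  apply/codomP; exists [ffun i => xchoose (ex i)]; apply/ffunP=> i.
  by rewrite !ffunE (eqP (xchooseP (ex i))).
apply/mem_Jsp => // x xA; apply: h; apply: contra xA => /codomP[y ->].
by rewrite spn_sub //; apply/forallP=> i; rewrite ffunE; apply/jA; exists (y i).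
Qed.

Lemma good_Isp B : submod B && (B != [set 0]) -> good_kernel p (Isp B).
Proof.
move=> /andP[HB B0]; have [Y [q [ql qE Yc]]] := quotient_exists HB.
exists (tuprep k Y), (fun n => push k (@hmap R T Y q n)); split.
- exact/IH/Yc.
- exact: natural_hmap.
move=> n; apply: lker_push_eq => x y.
apply/eqP/eqP=> /ffunP e; apply/ffunP=> i; have /eqP := e i; rewrite !ffunE.
  by rewrite -qE => /eqP.
by rewrite qE => /eqP.
Qed.

End Goodness.

(** * The group algebra k[Aut T] acting on k[T^n] *)

Section Convolution.
Variables (k : fieldType) (R : finPzRingType) (T : finRmod R).
Local Notation P := (tuprep k T).
Local Notation tup n := {ffun 'I_n -> T}.
Local Notation kG := {ffun {perm T} -> k^o}.

Definition conv (m : kG) n : 'End(P n) :=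
  \sum_(g in auts T) m g *: push k (fun x : tup n => tact x g).

Lemma convE m n (u : P n) z :
  conv m n u z = \sum_(g in auts T) m g * u (tact z g^-1%g).
Proof.
rewrite sum_lfunE sum_ffunE; apply: eq_bigr => g _.
rewrite scale_lfunE ffunE pushE (big_pred1 (tact z g^-1%g)) // => x.
by apply/eqP/eqP=> [<-|->]; rewrite ?tactK ?tactVK.
Qed.

Lemma conv_delta m n (x : tup n) :
  conv m n (delta k x) = \sum_(g in auts T) m g *: delta k (tact x g).
Proof.
by rewrite sum_lfunE; apply: eq_bigr => g _; rewrite scale_lfunE push_delta.
Qed.

Lemma conv_linear n (u : P n) : linear (fun m => conv m n u).
Proof.
move=> a m m'; rewrite /conv !sum_lfunE scaler_sumr -big_split /=.
by apply: eq_bigr => g _; rewrite !scale_lfunE !ffunE scalerDl scalerA.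
Qed.

Lemma natural_conv m : @natural _ _ P P (conv m).
Proof.
move=> n m' A u; rewrite /= !sum_lfunE linear_sum; apply: eq_bigr => g gG.
rewrite !scale_lfunE linearZ /= !push_comp; congr (_ *: _).
by apply: eq_push => x /=; rewrite mact_tact.
Qed.

Definition coefs n (u : P n) (x : tup n) : kG :=
  [ffun g => if g \in auts T then u (tact x g) else 0].

Lemma coefs_linear n (x : tup n) : linear (fun u : P n => coefs u x).
Proof.
move=> a u v; apply/ffunP=> g; rewrite !ffunE.
by case: ifP => // _; rewrite scaler0 addr0.
Qed.

Definition ltrans (h : {perm T}) (m : kG) : kG := [ffun g => m (h * g)%g].

Lemma ltrans_linear h : linear (ltrans h).
Proof. by move=> a u v; apply/ffunP=> g; rewrite !ffunE. Qed.

Lemma coefs_tact n (u : P n) x h : h \in auts T ->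
  coefs u (tact x h) = ltrans h (coefs u x).
Proof.
by move=> hG; apply/ffunP=> g; rewrite !ffunE groupMl // tactM.
Qed.

(** Multiplying by m yields coefficients that are combinations of left translates of m, so they stay
    in any translation-invariant subspace containing m. *)
Lemma coefs_conv (m : kG) n (u : P n) x : (forall g, g \notin auts T -> m g = 0) ->
  coefs (conv m n u) x =
  \sum_(g in auts T) u (tact x g) *: ltrans g^-1%g m.
Proof.
move=> m0; apply/ffunP=> h; rewrite ffunE sum_ffunE.
case: ifP => [hG|/negbT hG]; last first.
  rewrite big1 // => g gG; rewrite !ffunE m0 ?[_ *: _]mulr0 //.
  by rewrite groupMl ?groupV.
rewrite convE [RHS](reindex_onto (fun g => (h * g^-1)%g) (fun g => (g^-1 * h)%g)) /=.
  apply: eq_big => [g|g gG]; last first.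
    by rewrite !ffunE invMg invgK mulgKV tactM; apply: mulrC.
  by rewrite invMg invgK mulgKV eqxx andbT groupMl ?groupV.
by move=> g gG; rewrite invMg invgK mulKVg.
Qed.

(** [sum_mact] at all z together. The left side lies in every stable family containing u, hence so
    does the right side. *)
Lemma conv_key n m (x : tup n) (w : P m) (u : P n) : gen x -> coset_free w ->
  \sum_(A : 'M[R]_(n, m)) w (mact A x) *: op P A u =
  conv (coefs u x) m w *+ #|[set A : 'M[R]_(n, m) | mact A x == 0]|.
Proof.
move=> gx fw; apply/ffunP=> z; rewrite sum_ffunE.
under eq_bigr do rewrite ffunE /= pushE.
rewrite [LHS](sum_mact z u gx fw) ffunMnE convE; congr (_ *+ _).
by apply: eq_bigr => g gG; rewrite ffunE gG.
Qed.

End Convolution.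

(** * Representatives of the orbits of generating tuples *)

Section Transversal.
Variables (R : finPzRingType) (T : finRmod R).
Local Notation tup n := {ffun 'I_n -> T}.

Definition aorbit n (x : tup n) : {set tup n} := [set tact x g | g in auts T].

Lemma aorbit_refl n (x : tup n) : x \in aorbit x.
Proof. by apply/imsetP; exists 1%g; rewrite ?group1 ?tact1. Qed.

Lemma aorbit_tact n (x : tup n) g : g \in auts T -> aorbit (tact x g) = aorbit x.
Proof.
move=> gG; apply/setP=> y; apply/imsetP/imsetP=> -[h hG ->].
  by exists (g * h)%g; rewrite ?groupM ?tactM.
by exists (g^-1 * h)%g; rewrite ?groupM ?groupV // tactM tactK.
Qed.

Definition orbit_repr n (x : tup n) : tup n := odflt x [pick y in aorbit x].

Lemma orbit_reprP n (x : tup n) : orbit_repr x \in aorbit x.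
Proof.
by rewrite /orbit_repr; case: pickP => //= _; apply: aorbit_refl.
Qed.

Lemma orbit_repr_tact n (x : tup n) g : g \in auts T ->
  orbit_repr (tact x g) = orbit_repr x.
Proof.
move=> gG; rewrite /orbit_repr (eq_pick (Q := [in aorbit x])).
  by case: pickP => //= /(_ x); rewrite aorbit_refl.
by move=> y; rewrite /= aorbit_tact.
Qed.

Definition gen_reprs n : {set tup n} := [set x | gen x & orbit_repr x == x].

Lemma orbit_repr_gen n (y : tup n) : gen y -> orbit_repr y \in gen_reprs n.
Proof.
rewrite inE => gy; have /imsetP[g gG yE] := orbit_reprP y.
by rewrite yE gen_tact // gy orbit_repr_tact // yE eqxx.
Qed.

Lemma card_gen_reprs n :
  (#|gen_reprs n| * #|auts T| = #|[set x : tup n | gen x]|)%N.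
Proof.
rewrite -[RHS]sum1_card (partition_big (@orbit_repr n) [in gen_reprs n]) /=.
  rewrite -sum_nat_const; apply: eq_bigr => x; rewrite inE => /andP[gx /eqP xr].
  rewrite sum1_card -(card_in_imset (tact_inj gx)); apply: eq_card => y.
  rewrite [RHS]unfold_in /= inE; apply/idP/andP=> [/imsetP[g gG ->]|[gy /eqP yx]].
    by rewrite gen_tact // orbit_repr_tact // xr.
  have /imsetP[g gG xE] := orbit_reprP y.
  apply/imsetP; exists g^-1%g; first by rewrite groupV.
  by rewrite -yx xE tactK.
by move=> y; rewrite inE; apply: orbit_repr_gen.
Qed.

Lemma gen_reprs_tact n (x y : tup n) g : x \in gen_reprs n -> y \in gen_reprs n ->
  g \in auts T -> y = tact x g -> y = x.
Proof.
move=> xX yX gG yE; move: xX yX; rewrite ![_ \in gen_reprs n]inE.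
by move=> /andP[_ /eqP xr] /andP[_ /eqP yr]; rewrite -yr yE orbit_repr_tact // xr.
Qed.

End Transversal.

(** * The induction step *)

Section GoodStep.
Variables (k : fieldType) (R : finPzRingType) (p : nat).
Hypotheses (pp : prime p) (Rp : exists e, #|R| = (p ^ e)%N) (pk : p%:R != 0 :> k).
Variable T : finRmod R.
Local Notation P := (tuprep k T).
Local Notation tup n := {ffun 'I_n -> T}.
Local Notation kG := {ffun {perm T} -> k^o}.
Hypothesis IH : forall Y : finRmod R, (#|Y| < #|T|)%N -> good p (tuprep k Y).

Definition Jsum n : {vspace P n} :=
  (\sum_(A : {set T} | submod A && (A != setT)) Jsp k A n)%VS.
Definition Icap n : {vspace P n} :=
  (\bigcap_(B : {set T} | submod B && (B != [set 0%R])) Isp k B n)%VS.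

(** A non-generating tuple spans a proper submodule, whose summand contains the corresponding basis
    vector. *)
Lemma mem_Jsum n (u : P n) :
  reflect (forall x : tup n, gen x -> u x = 0) (u \in Jsum n).
Proof.
apply: (iffP idP) => [/memv_sumP[v vJ ->] x gx|u0].
  rewrite sum_ffunE big1 // => A /[dup] QA /andP[HA AT].
  apply: (elimT (mem_Jsp _ HA)) (vJ A QA) _ _.
  by rewrite (eqP gx) subTset.
rewrite [u]ffun_delta; apply: memv_suml => x _.
have [gx|ngx] := boolP (gen x); first by rewrite u0 // scale0r mem0v.
rewrite memvZ //; apply: (subvP (sumv_sup (spn x) _ (subvv _))).
  by rewrite spn_submod.
apply/mem_Jsp => [|y ny]; first exact: spn_submod.
by rewrite ffunE; case: eqP ny => // ->; rewrite subxx.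
Qed.

Lemma coset_free_Icap n (w : P n) : w \in Icap n -> coset_free w.
Proof.
move=> wI B HB B0 v.
have : w \in Isp k B n.
  apply: (subvP _ _ wI); rewrite /Icap.
  by apply: (bigcapv_inf B); rewrite ?HB ?subvv.
by move/mem_lker_push/(_ v).
Qed.

Lemma polydim_sub_Jsum U : @stable _ _ P U -> (forall n, (U n <= Jsum n)%VS) ->
  polydim p U.
Proof. by move=> sU; apply: polydim_sub_sum sU => A; apply: good_Jsp. Qed.

Lemma polydim_sup_Icap U : @stable _ _ P U -> (forall n, (Icap n <= U n)%VS) ->
  polyfun p (fun n => (\dim {:P n})%:R - (\dim (U n))%:R).
Proof. by move=> sU; apply: polydim_sup_cap sU => B; apply: good_Isp. Qed.

Lemma stable_Jsum : @stable _ _ P Jsum.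
Proof.
move=> n m A u /mem_Jsum u0; apply/mem_Jsum=> x gx; rewrite pushE.
rewrite big1 // => y /eqP yx; apply: u0; rewrite /gen -subTset -(eqP gx).
apply/subsetP=> t /imsetP[c _ ->]; apply/imsetP.
exists [ffun i => \sum_j A i j * c j] => //.
rewrite -yx; under eq_bigr do rewrite ffunE racts_suml.
rewrite exchange_big; apply: eq_bigr => i _ /=.
by rewrite ffunE racts_sumr; apply: eq_bigr => j _; rewrite ractsA.
Qed.

(** One copy of the group algebra per orbit of generating tuples; the kernel is J, so this realizes
    P_T/J concretely. *)
Definition repr_coefs n (u : P n) : {ffun tup n -> kG} :=
  [ffun x => if x \in gen_reprs T n then coefs u x else 0].

Lemma repr_coefs_linear n : linear (@repr_coefs n).
Proof.
move=> a u v; apply/ffunP=> x; rewrite !ffunE.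
by case: ifP => _; rewrite ?coefs_linear // scaler0 addr0.
Qed.
HB.instance Definition _ n :=
  GRing.isLinear.Build k (P n) {ffun tup n -> kG} _ (@repr_coefs n)
    (@repr_coefs_linear n).

Lemma lker_repr_coefs n : lker (linfun (@repr_coefs n)) = Jsum n.
Proof.
apply/vspaceP=> u; rewrite memv_ker lfunE /=.
apply/eqP/mem_Jsum=> [/ffunP u0 y gy|u0].
  have /imsetP[g gG xE] := orbit_reprP y.
  have := u0 (orbit_repr y); rewrite !ffunE orbit_repr_gen // => /ffunP/(_ g^-1%g).
  by rewrite !ffunE groupV gG xE tactK.
apply/ffunP=> x; rewrite !ffunE; case: ifP => //; rewrite inE => /andP[gx _].
apply/ffunP=> g; rewrite !ffunE; case: ifP => // gG.
by rewrite u0 // gen_tact.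
Qed.

Lemma repr_coefs_delta n x (m : kG) : x \in gen_reprs T n ->
  (forall g, g \notin auts T -> m g = 0) ->
  repr_coefs (conv m n (delta k x)) = single kG x m.
Proof.
move=> xX m0; apply/ffunP=> y; rewrite singleE ffunE.
have gx : gen x by move: xX; rewrite inE => /andP[].
case: ifP => [yX|yX]; last by case: eqP yX => // ->; rewrite xX.
apply/ffunP=> h; rewrite ffunE; case: ifP => [hG|/negbT hG]; last first.
  by case: ifP => _; rewrite ?m0 // ffunE.
rewrite conv_delta sum_ffunE; case: eqP => [->|yx].
  rewrite (bigD1 h) //= big1 ?addr0; first by rewrite !ffunE eqxx; apply: mulr1.
  move=> g /andP[gG /negPf gh]; rewrite !ffunE; case: eqP => [e|_]; last exact: mulr0.
  by rewrite (tact_inj gx hG gG e) eqxx in gh.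
rewrite ffunE big1 // => g gG; rewrite !ffunE; case: eqP => [e|_]; last exact: mulr0.
case: yx; apply: (@gen_reprs_tact _ _ _ x y (g * h^-1)%g) => //.
  by rewrite groupM ?groupV.
by rewrite tactM -e tactK.
Qed.

Section Subfunctor.
Variable K : forall n, {vspace P n}.
Hypothesis sK : @stable _ _ P K.

(* Quantifying over h makes the predicate invariant under left translation,    *)
(* without having to know that Icap is invariant under automorphisms.          *)
Definition coef_pred (m : kG) : Prop :=
  (forall g, g \notin auts T -> m g = 0) /\
  forall h, h \in auts T -> forall n w, w \in Icap n -> conv (ltrans h m) n w \in K n.

Lemma coef_pred0 : coef_pred 0.
Proof.
split=> [g _|h _ n w _]; first by rewrite ffunE.
have -> : ltrans h 0 = 0 :> kG by apply/ffunP=> g; rewrite !ffunE.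
rewrite /conv sum_lfunE big1 ?mem0v // => g _.
by rewrite scale_lfunE ffunE scale0r.
Qed.

Lemma coef_predZD a m m' :
  coef_pred m -> coef_pred m' -> coef_pred (a *: m + m').
Proof.
move=> [m0 mK] [m'0 m'K]; split=> [g gG|h hG n w wI].
  by rewrite !ffunE m0 // m'0 // scaler0 addr0.
by rewrite ltrans_linear conv_linear memvD ?memvZ ?mK ?m'K.
Qed.

Lemma coef_pred_ltrans h m : h \in auts T -> coef_pred m -> coef_pred (ltrans h m).
Proof.
move=> hG [m0 mK]; split=> [g gG|h' h'G n w wI].
  by rewrite ffunE m0 // groupMl.
have -> : ltrans h' (ltrans h m) = ltrans (h * h')%g m.
  by apply/ffunP=> g; rewrite !ffunE mulgA.
by apply: mK; rewrite ?groupM.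
Qed.

(** Translating the coefficients by h amounts to replacing x by the generating tuple hx. Then
    [conv_key] puts a multiple of the product in K, and the factor, a power of p, is invertible in
    k. *)
Lemma coef_pred_coefs n (u : P n) x : u \in K n -> gen x -> coef_pred (coefs u x).
Proof.
move=> uK gx; split=> [g /negPf gG|h hG m w wI]; first by rewrite ffunE gG.
rewrite -coefs_tact //; set y := tact x h.
have gy : gen y by rewrite gen_tact.
have key := conv_key u gy (coset_free_Icap wI).
have [j cj] := card_fiber_pow m gy pp Rp.
have c0 : #|[set A : 'M[R]_(n, m) | mact A y == 0]|%:R != 0 :> k.
  by rewrite cj natrX expf_neq0.
rewrite -[X in X \in _]scale1r -(mulVf c0) -scalerA scaler_nat -key.
apply/memvZ/memv_suml=> A _; apply/memvZ; exact: sK.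
Qed.

(** Uses dim K = dim (K ∩ J) + dim (L/J) - dim (L/(K + J)), where each term is polynomial in p^n. *)
Lemma polydim_step : polydim p K.
Proof.
have [M ME] := vspace_of_pred coef_pred0 coef_predZD.
pose s : seq kG := vbasis M.
have sM m : m \in s -> coef_pred m.
  by move=> ms; apply/ME/vbasis_mem.
pose W n := (K n + Jsum n)%VS.
have sW : @stable _ _ P W by exact: stable_add sK stable_Jsum.
pose L n := (W n + \sum_(m <- s) limg (conv m n))%VS.
(* The same finite basis [s] of M serves for all n, and each m in it sends I into K (translation by
   the identity in [coef_pred]). *)
have h1 : polyfun p (fun n => (\dim (L n))%:R - (\dim (W n))%:R).
  apply: (polydim_add_limg (I := Icap)) => //.
  - exact: polydim_sup_Icap.
  - by move=> m _; apply: natural_conv.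
  move=> m n ms; apply/subvP=> w wI; rewrite -memv_preim.
  apply: (subvP (addvSl _ _)).
  have [_ /(_ 1%g (group1 _) n w wI)] := sM m ms.
  have -> // : ltrans 1%g m = m by apply/ffunP=> g; rewrite ffunE mul1g.
pose ev n := linfun (@repr_coefs n).
(* L/J is one copy of M per orbit: [Lgen] bounds it from above, and m applied to the basis vector of
   a representative x realizes m in the copy at x. *)
have evL n : (ev n @: L n = \sum_(x in gen_reprs T n) single kG x @: M)%VS.
  have Lgen x u : u \in L n -> gen x -> coefs u x \in M.
    move=> uL gx; apply/ME; move: uL.
    case/memv_addP=> [_ /memv_addP[u1 u1K [u2 /mem_Jsum u2J ->]] [u3 u3S ->]].
    have E : coefs u2 x = 0.
      apply/ffunP=> g; rewrite !ffunE; case: ifP => // gG.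
      by rewrite u2J // gen_tact.
    rewrite -[u1 + u2 + u3]addrA -[u1]scale1r coefs_linear -[u2]scale1r coefs_linear E scaler0 add0r.
    apply: coef_predZD; first exact: coef_pred_coefs.
    apply/ME; move: u3 u3S.
    have lin : linear (fun u : P n => coefs u x) by apply: coefs_linear.
    pose cM := GRing.isLinear.Build k (P n) kG _ _ lin.
    pose cL : {linear P n -> kG} := HB.pack (fun u : P n => coefs u x) cM.
    have le : (\sum_(m <- s) limg (conv m n) <= linfun cL @^-1: M)%VS.
      elim: (s) sM => [|m t IHt] st; first by rewrite big_nil sub0v.
      rewrite big_cons subv_add IHt ?andbT; last first.
        by move=> l lt; apply: st; rewrite inE lt orbT.
      apply/subvP=> _ /memv_imgP[v _ ->]; rewrite -memv_preim lfunE /=.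
      have mc := st m (mem_head m t).
      rewrite coefs_conv; last by case: mc.
      apply: memv_suml => g gG; apply: memvZ; apply/ME.
      by apply: coef_pred_ltrans => //; rewrite groupV.
    by move=> u3 /(subvP le); rewrite -memv_preim lfunE.
  apply/eqP; rewrite eqEsubv; apply/andP; split.
    apply/subvP=> _ /memv_imgP[u uL ->]; rewrite lfunE /=.
    have -> : repr_coefs u = \sum_(x in gen_reprs T n) single kG x (coefs u x).
      apply/ffunP=> x; rewrite ffunE sum_ffunE; case: ifP => xX.
        rewrite (bigD1 x) //= big1 ?addr0 => [|y /andP[_ /negPf yx]].
          by rewrite singleE eqxx.
        by rewrite singleE eq_sym yx.
      rewrite big1 // => y yX; rewrite singleE; case: eqP => // xy.
      by rewrite xy yX in xX.
    apply: memv_suml => x xX; apply: (subvP (sumv_sup x xX (subvv _))).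
    by apply/memv_img/Lgen => //; move: xX; rewrite inE => /andP[].
  apply/subv_sumP=> x xX; apply/subvP=> _ /memv_imgP[m mM ->].
  have [m0 _] := (ME m).1 mM.
  rewrite -repr_coefs_delta // -[repr_coefs _](lfunE (@repr_coefs n)).
  apply: memv_img; rewrite /L; apply: (subvP (addvSr _ _)).
  have lin : linear (fun m => conv m n (delta k x)) by apply: conv_linear.
  pose cM := GRing.isLinear.Build k kG (P n) _ _ lin.
  pose cL : {linear kG -> P n} := HB.pack (fun m => conv m n (delta k x)) cM.
  have : m \in (linfun cL @^-1: \sum_(m <- s) limg (conv m n))%VS.
    apply: (subvP _ _ mM); rewrite -(span_basis (vbasisP M)).
    apply/span_subvP=> l ls; rewrite -memv_preim lfunE /= (big_rem l ls) /=.
    by apply: (subvP (addvSl _ _)); apply: memv_img; apply: memvf.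
  by rewrite -memv_preim lfunE.
have dimL n : (\dim (L n))%:R = (\dim (Jsum n))%:R + #|gen_reprs T n|%:R * (\dim M)%:R :> rat.
  rewrite -(limg_ker_dim (ev n) (L n)) evL dim_sum_single natrD natrM lker_repr_coefs.
  congr ((\dim _)%:R + _); apply/capv_idPr.
  by apply: subv_trans (addvSl _ _); apply: addvSr.
have h2 : polyfun p (fun n => (\dim (Jsum n))%:R).
  by apply: polydim_sub_Jsum => [|n]; [apply: stable_Jsum | apply: subvv].
have h3 : polyfun p (fun n => (\dim (K n :&: Jsum n))%:R).
  apply: polydim_sub_Jsum => [|n]; last exact: capvSr.
  exact: stable_cap sK stable_Jsum.
have h4 : polyfun p (fun n => #|gen_reprs T n|%:R).
  (* The action is free, so the number of orbits is the number of generating tuples divided by |Aut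
     T|. *)
  apply: eq_polyfun (polyfunM (polyfun_card_gen pp Rp T) (polyfun_const p (#|auts T|%:R^-1))) => n.
  rewrite -card_gen_reprs natrM mulfK // pnatr_eq0 -lt0n.
  exact: cardG_gt0.
apply: eq_polyfun (polyfunB (polyfunD h3 (polyfunM h4 (polyfun_const p (\dim M)%:R))) h1) => n.
have := dim_sum_cap_rat (K n) (Jsum n); rewrite dimL -/(W n).
by lra.
Qed.

End Subfunctor.
End GoodStep.

(** * Finitely generated functors *)

Theorem good_tuprep (k : fieldType) (R : finPzRingType) (p : nat) :
  prime p -> (exists e, #|R| = (p ^ e)%N) -> p%:R != 0 :> k ->
  forall T : finRmod R, good p (tuprep k T).
Proof.
move=> pp Rp pk T; have [c] := ubnP #|T|; elim: c T => // c IH T /ltnSE leT K sK.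
by apply: polydim_step sK => // Y YT; apply/IH/(leq_trans YT).
Qed.

Section Columns.
Variables (R : finPzRingType) (r : nat).

(** A separate name to carry the right action on T = R^r. Its n-tuples are the r by n matrices, i.e.
    Hom(R^r, R^n). *)
Definition columns : Type := 'cV[R]_r.
HB.instance Definition _ := FinRing.Zmodule.on columns.

Definition columns_act (x : columns) (a : R) : columns := \col_i (x i 0 * a).

Fact columns_actA x a b : columns_act x (a * b) = columns_act (columns_act x a) b.
Proof. by apply/colP=> i; rewrite !mxE mulrA. Qed.
Fact columns_act1 x : columns_act x 1 = x.
Proof. by apply/colP=> i; rewrite !mxE mulr1. Qed.
Fact columns_actDl x y a : columns_act (x + y) a = columns_act x a + columns_act y a.
Proof. by apply/colP=> i; rewrite !mxE mulrDl. Qed.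
Fact columns_actDr x a b : columns_act x (a + b) = columns_act x a + columns_act x b.
Proof. by apply/colP=> i; rewrite !mxE mulrDr. Qed.
HB.instance Definition _ := isRightModule.Build R columns
  columns_actA columns_act1 columns_actDl columns_actDr.

Definition tuple_mx n (x : {ffun 'I_n -> columns}) : 'M[R]_(r, n) :=
  \matrix_(i, j) (x j : 'cV[R]_r) i 0.

Lemma tuple_mx_act n m (A : 'M[R]_(n, m)) x :
  tuple_mx (mact A x) = tuple_mx x *m A.
Proof.
apply/matrixP=> i j; rewrite !mxE ffunE summxE.
by apply: eq_bigr => l _; rewrite !mxE.
Qed.

End Columns.

Definition free_map (R : finPzRingType) n m (A : 'M[R]_(n, m)) :
  {linear free_mod R n -> free_mod R m} := mulmxr A.

Section Coverings.
Variables (k : fieldType) (R : finPzRingType) (p : nat).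

(** The dimension statement only involves the modules R^n, so it is enough to cover G on them,
    compatibly with matrices. *)
Definition covered (G : functor R k) : Prop :=
  exists (X : vrep k (fun n m => 'M[R]_(n, m)))
    (psi : forall n, {linear X n -> G (free_mod R n)}),
  [/\ good p X, forall n y, exists u, psi n u = y &
      forall n m (A : 'M[R]_(n, m)) u,
        psi m (op X A u) = fmap G (free_map A) (psi n u)].

Lemma covered_quotient (F G : functor R k) (phi : nat_trans G F) :
  covered G -> (forall b (y : F b), exists x, phi b x = y) -> covered F.
Proof.
move=> [X [psi [gX psiS psiN]]] phiS.
exists X, (fun n => phi (free_mod R n) \o psi n); split=> // [n y|n m A u] /=.
  by have [x <-] := phiS _ y; have [u <-] := psiS n x; exists u.
by rewrite psiN -[LHS]/((phi _ \o _) _) nt_natural.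
Qed.

Hypotheses (pp : prime p) (Rp : exists e, #|R| = (p ^ e)%N) (pk : p%:R != 0 :> k).

Section RepCovered.
Variables (a : fgproj R) (r : nat) (s : {linear a -> 'rV[R]_r}).
Variable t : {linear 'rV[R]_r -> a}.
Hypothesis st : forall x, t (s x) = x.

Definition tuple_hom n (x : {ffun 'I_n -> columns R r}) : hom a (free_mod R n) :=
  (mulmxr (tuple_mx x) \o s : {linear a -> 'rV[R]_n}).

Definition rep_cover n (u : tuprep k (columns R r) n) : rep k a (free_mod R n) :=
  \sum_x u x *: << 1 *g tuple_hom x >>.

Lemma rep_cover_linear n : linear (@rep_cover n).
Proof.
move=> c u v; rewrite /rep_cover scaler_sumr -big_split /=.
by apply: eq_bigr => x _; rewrite !ffunE scalerDl scalerA.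
Qed.
HB.instance Definition _ n := GRing.isLinear.Build k (tuprep k (columns R r) n)
  (rep k a (free_mod R n)) _ (@rep_cover n) (@rep_cover_linear n).

Lemma rep_cover_delta n x : rep_cover (delta k x) = << tuple_hom x >> :> rep k a (free_mod R n).
Proof.
rewrite /rep_cover (bigD1 x) //= big1 ?addr0 => [|y /negPf yx].
  by rewrite ffunE eqxx scale1r.
by rewrite ffunE yx scale0r.
Qed.

Definition hom_tuple n (h : hom a (free_mod R n)) : {ffun 'I_n -> columns R r} :=
  [ffun j => \col_i ((h : {linear a -> 'rV[R]_n}) (t (delta_mx 0 i))) 0 j].

Lemma hom_tupleK n (h : hom a (free_mod R n)) : tuple_hom (hom_tuple h) = h.
Proof.
apply: linear_eqfun => x /=; rewrite -[in RHS](st x) [in RHS](row_sum_delta (s x)) !linear_sum.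
apply/rowP=> j; rewrite summxE !mxE; apply: eq_bigr => i _.
by rewrite !linearZ !mxE ffunE !mxE.
Qed.

(** Since a is a retract of R^r, restriction along s maps Hom(R^r, R^n) onto Hom(a, R^n): the
    homomorphism h comes from h ∘ t. *)
Lemma covered_rep : covered (rep k a).
Proof.
exists (tuprep k (columns R r)), (fun n => @rep_cover n); split.
- exact: good_tuprep.
- move=> n y; exists (\sum_(e <- msupp y) y@_e *: delta k (hom_tuple e)).
  rewrite [RHS]monalgE linear_sum; apply: eq_bigr => e _.
  rewrite linearZ /= rep_cover_delta hom_tupleK.
  by apply/malgP => l; rewrite mcoeffZ !mcoeffU mulrnAr mulr1.
move=> n m A u; rewrite [in LHS](ffun_delta u) !linear_sum.
apply: eq_bigr => x _; rewrite !linearZ /= push_delta rep_cover_delta malg_mapU.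
congr (_ *: << _ >>); apply: linear_eqfun => v /=.
by rewrite tuple_mx_act mulmxA.
Qed.

End RepCovered.

Lemma covered_foldr (l : seq (fgproj R)) :
  covered (foldr (@dsum R k) (zero_functor R k) (map (rep k) l)).
Proof.
elim: l => [|a l [X [psi [gX psiS psiN]]]] /=.
  exists (tuprep k (columns R 0)), (fun n => \0 : {linear _ -> 'rV[k]_0}); split.
  - exact: good_tuprep.
  - by move=> n y; exists 0; apply/rowP=> -[].
  - by move=> n m A u; apply/rowP=> -[].
(* Finite generation gives t from R^r onto a, and projectivity a section s of t. *)
have [[r [g gS]] aP] := fgprojP a.
pose t_fun (v : 'rV[R]_r) : a := \sum_i v 0 i *: g i.
have t_lin : linear t_fun.
  move=> c u v; rewrite /t_fun scaler_sumr -big_split /=.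
  by apply: eq_bigr => i _; rewrite !mxE scalerDl scalerA.
pose tM := GRing.isLinear.Build R _ _ _ t_fun t_lin.
pose t : {linear 'rV[R]_r -> a} := HB.pack t_fun tM.
have tS y : exists x, t x = y.
  have [c ->] := gS y; exists (\row_i c i).
  by apply: eq_bigr => i _; rewrite mxE.
have [s st] := aP _ _ t idfun tS.
have [Y [chi [gY chiS chiN]]] := covered_rep st.
pose phi n (u : prod_rep Y X n) : dsum (rep k a) _ (free_mod R n) := (chi n u.1, psi n u.2).
have phi_lin n : linear (phi n) by move=> c u v; rewrite /phi /= !linearP.
pose phiM n := GRing.isLinear.Build k _ _ _ (phi n) (phi_lin n).
pose phiL n : {linear prod_rep Y X n -> _} := HB.pack (phi n) (phiM n).
exists (prod_rep Y X), phiL; split.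
- exact: good_prod.
- move=> n [y1 y2]; have [u1 <-] := chiS n y1; have [u2 <-] := psiS n y2.
  by exists (u1, u2).
by move=> n m A [u1 u2]; rewrite /= lfunE /= /phi /= chiN psiN.
Qed.

(** W has no basis in advance: a complement C of the kernel is mapped isomorphically onto W, and the
    coordinates of C are transported. *)
Lemma has_dim_quotient (V : vectType k) (W : lmodType k) (f : {linear V -> W})
    (U : {vspace V}) :
  (forall y, exists u, f u = y) -> (forall u, u \in U <-> f u = 0) ->
  has_dim W (\dim {:V} - \dim U).
Proof.
move=> fS UE; pose C := (U^C)%VS.
have preE y : exists u, u \in C /\ f u = y.
  have [v <-] := fS y; have := memvf v; rewrite -(addv_complf U).
  move=> /memv_addP[u /UE fu0 [c cC ->]]; exists c; split=> //.
  by rewrite linearD fu0 add0r.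
pose pre y := projT1 (cid (preE y)).
have preC y : pre y \in C by rewrite /pre; case: cid => ? [].
have fpre y : f (pre y) = y by rewrite /pre; case: cid => ? [].
have preK c : c \in C -> pre (f c) = c.
  move=> cC; apply/eqP; rewrite -subr_eq0 -memv0 -(capv_compl U) memv_cap.
  apply/andP; split; last by rewrite memvB.
  by apply/UE; rewrite linearB fpre subrr.
have pre_lin : linear pre.
  move=> a x y; rewrite -(preK (a *: pre x + pre y)); last by rewrite rpredD ?rpredZ.
  by rewrite linearP !fpre.
rewrite -dimv_compl -/C; constructor.
pose v2r y : 'rV[k]_(\dim C) := \row_i coord (vbasis C) i (pre y).
exists v2r.
  move=> a x y; apply/rowP=> i; rewrite !mxE pre_lin linearP //.
exists (fun w : 'rV[k]_(\dim C) => f (\sum_(i < \dim C) w 0 i *: (vbasis C)`_i)) => [y|w].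
  rewrite -[RHS]fpre [in RHS](coord_vbasis (preC y)); congr (f _).
  by apply: eq_bigr => i _; rewrite mxE.
apply/rowP=> i; rewrite mxE preK; last first.
  apply: rpred_sum => j _; rewrite rpredZ // vbasis_mem // mem_nth // size_tuple //.
by rewrite coord_sum_free // (basis_free (vbasisP C)).
Qed.

End Coverings.

Theorem mainTheorem7 (k : fieldType) (p : nat) (R : finPzRingType)
    (hp : prime p) (hk : p \notin [pchar k])
    (hR : exists m : nat, #|R| = (p ^ m)%N)
    (F : functor R k) (hF : finitely_generated_functor F) :
  exists P : {poly rat}, forall n : nat, exists d : nat,
    has_dim (F (free_mod R n)) d /\ d%:R = P.[(p ^ n)%:R].
Proof.
have pk : p%:R != 0 :> k by move: hk; rewrite inE hp.
have [l [phi phiS]] := hF.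
have [X [psi [gX psiS psiN]]] := covered_quotient (covered_foldr hp hR pk l) phiS.
have exK n : exists U : {vspace X n}, forall u, u \in U <-> psi n u = 0.
  apply: vspace_of_pred => [|a u v u0 v0]; first exact: linear0.
  by rewrite linearP u0 v0 scaler0 addr0.
pose K n := projT1 (cid (exK n)).
have KE n u : u \in K n <-> psi n u = 0 by rewrite /K; case: cid.
have sK : @stable _ _ X K.
  by move=> n m A u /KE u0; apply/KE; rewrite psiN u0 linear0.
(* Goodness of X is applied twice, to the whole family and to the kernel of the covering. *)
have [P PE] := polyfunB (gX _ (@stable_full _ _ X)) (gX _ sK).
exists P => n; exists (\dim {:X n} - \dim (K n))%N; split.
  exact: has_dim_quotient (psiS n) (KE n).
by rewrite natrB ?PE // dimvS ?subvf.
Qed.
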